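(* Let $M_1,\ldots,M_s$ be $m\times m$ positive semidefinite matrices such that $\sum_{k=1}^sM_k$ has full rank $m$, let $N\ge1$ be an integer, let $p\in[0,1]$, and let $\boldsymbol{w}^*$ be an optimal solution of the continuous problem $$\max\Big\{\Phi_p\big(M_F(\boldsymbol{w})\big):\ \boldsymbol{w}\in\mathbb{R}_+^s,\ \sum_{k=1}^sw_k\le N\Big\}.$$ Then, for any $\boldsymbol{n}\in\mathbb{N}^s$ (not necessarily satisfying $\sum_in_i=N$), $$\frac1N\sum_{i\in[s]}n_i^p\,(w_i^* )^{1-p}\ \le\ \frac{\varphi_p(\boldsymbol{n})}{\varphi_p(\boldsymbol{w}^* )}.$$
   Context: $[s]:=\{1,\ldots,s\}$, $\mathbb{N}$ contains $0$; positive semidefinite matrices are real symmetric. For $\boldsymbol{w}\in\mathbb{R}_+^s$, $M_F(\boldsymbol{w}):=\sum_{i=1}^sw_iM_i$. For an $m\times m$ positive semidefinite matrix $M$ with eigenvalues $\lambda_1,\dots,\lambda_m$ (with multiplicities), $\operatorname{trace}M^p:=\sum_k\lambda_k^p$ if $p\in(0,1]$ and $\operatorname{trace}M^0:=\operatorname{rank}M$. The criterion is $\Phi_p(M)=\big(\frac1m\operatorname{trace}M^p\big)^{1/p}$ for $p\in(0,1]$, and $\Phi_0(M)=(\det M)^{1/m}$. Moreover $\varphi_p(\boldsymbol{w}):=\operatorname{trace}M_F(\boldsymbol{w})^p$ for $\boldsymbol{w}\in\mathbb{R}_+^s$ (in particular for $\boldsymbol{w}=\boldsymbol{n}\in\mathbb{N}^s$);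 it is a rank when $p=0$. For the scalar powers $n_i^p$ and $(w_i^* )^{1-p}$ the convention $0^0=0$ is adopted. *)

(* Defs.v *)
From HB Require Import structures.
From mathcomp Require Import all_boot all_order all_algebra.
From mathcomp Require Import polyrcf.
From mathcomp Require Import reals exp.

Set Implicit Arguments.
Unset Strict Implicit.
Unset Printing Implicit Defensive.

Import Order.TTheory GRing.Theory Num.Theory.
Local Open Scope ring_scope.

Section Defs.
Variable R : realType.

Definition psdmx m (M : 'M[R]_m) : Prop :=
  M \is symmetricmx /\ forall x : 'cV[R]_m, 0 <= (x^T *m M *m x) 0 0.

(* The real roots of the characteristic polynomial, each repeated according to
   its multiplicity; for symmetric M there are m of them. *)
Definition eigenvals m (M : 'M[R]_m) : seq R :=
  flatten [seq nseq (mup x (char_poly M)) x | x <- rootsR (char_poly M)].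

Lemma eigenvalsP m (M : 'M[R]_m) (l : seq R) :
  char_poly M = \prod_(x <- l) ('X - x%:P) -> perm_eq (eigenvals M) l.
Proof.
move=> Ml; apply/allP => x _ /=; apply/eqP.
have nz : char_poly M != 0 by rewrite monic_neq0 // char_poly_monic.
rewrite /eigenvals count_flatten -map_comp sumnE big_map.
under eq_bigr => y _ do rewrite /= count_nseq /=.
rewrite -(mu_prod_XsubC x l) -Ml.
have Ru : uniq (rootsR (char_poly M)) by exact: uniq_roots.
have [xin|xnin] := boolP (x \in rootsR (char_poly M)).
  rewrite (bigD1_seq x) //= eqxx mul1n big1 ?addn0 // => y /negPf yx.
  by rewrite yx.
rewrite big_seq big1 => [|y yin]; last first.
  by case: eqP => // yx; rewrite -yx yin in xnin.
rewrite mupNroot //; apply: contra xnin => rx.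
by rewrite -(roots_on_rootsR nz) in_itv.
Qed.

(* trace M^p for positive semidefinite M and p in [0, 1] *)
Definition trace_pow m (p : R) (M : 'M[R]_m) : R :=
  if p == 0 then (\rank M)%:R else \sum_(x <- eigenvals M) x `^ p.

Definition Phi m (p : R) (M : 'M[R]_m) : R :=
  if p == 0 then (\det M) `^ m%:R^-1
  else (m%:R^-1 * trace_pow p M) `^ p^-1.

Definition infomx m s (M : 'I_s -> 'M[R]_m) (w : 'I_s -> R) : 'M[R]_m :=
  \sum_i w i *: M i.

Definition phi m s (M : 'I_s -> 'M[R]_m) (p : R) (w : 'I_s -> R) : R :=
  trace_pow p (infomx M w).

Definition feasible s (N : nat) (w : 'I_s -> R) : Prop :=
  (forall i, 0 <= w i) /\ \sum_i w i <= N%:R.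

Definition optimal m s (M : 'I_s -> 'M[R]_m) (N : nat) (p : R)
    (w : 'I_s -> R) : Prop :=
  feasible N w /\
  forall v, feasible N v -> Phi p (infomx M v) <= Phi p (infomx M w).

(* Scalar power with the convention 0^0 = 0, whereas 0 `^ 0 = 1. *)
Definition pow00 (a p : R) : R := if a == 0 then 0 else a `^ p.

End Defs.

(* Main.v *)
(* Let H = M_F(w), E_i = w_i M_i and t_i = n_i / w_i.  First-order optimality of
   w gives tr (E_i H^(p-1)) >= (w_i / N) tr H^p, so that it suffices to bound
   \sum_i t_i^p tr (E_i H^(p-1)) by tr (\sum_i t_i E_i)^p.

   For 0 < p < 1 this is the tangent inequality at y = 1 of the function
   Psi(y) = tr (\sum_i y_i^(1/p) E_i)^p, which is homogeneous of degree 1 and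
   convex.  Convexity is proved without differentiating a matrix function.  For
   two points y and y' with matrices H and L, write all traces in the
   eigenbases u_j of H and v_k of L, with weights <u_j, v_k>^2; a Schur
   complement bounds \sum_i t_i^-1 tr (E_i H^(p-1)) from below by
   tr (H^(p-1) H L^-1 H), and then
   <grad Psi(y') - grad Psi(y), y' - y> >= - C |y' - y|^3
   reduces to an inequality between pairs of eigenvalues.  Summing over a fine
   subdivision of a segment shows that grad Psi is monotone along it.

   For p = 0 one uses instead that tr (H^-1 A) <= rank A whenever A <= H, and
   for p = 1 everything is linear. *)
From mathcomp Require Import all_boot all_order all_algebra.
From mathcomp Require Import complex.
From mathcomp Require Import boolp functions reals topology normedtype.
From mathcomp Require Import sequences derive exp.
From mathcomp Require Import ring lra.
Require Import Defs.
Set Implicit Arguments.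
Unset Strict Implicit.
Unset Printing Implicit Defensive.

Import Order.TTheory GRing.Theory Num.Theory.
Import numFieldNormedType.Exports.
Local Open Scope ring_scope.

(** * Inequalities for real powers *)

Section Scalar.
Variable R : realType.
Implicit Types (p q t x h l : R).

Lemma derive_ge0_le (f df : R -> R) (a b : R) : a <= b ->
  (forall x, a <= x <= b -> is_derive x 1 f (df x)) ->
  (forall x, a < x < b -> 0 <= df x) -> f a <= f b.
Proof.
rewrite le_eqVlt => /predU1P[-> //|ab] fdf df0.
have [||c] := MVT ab (f := f) (df := df).
- by move=> x; rewrite in_itv /= => /andP[ax xb]; apply: fdf; rewrite !ltW.
- apply: derivable_within_continuous => x; rewrite in_itv /= => xab.
  by have [] := fdf x xab.
rewrite in_itv /= => /df0 fc0 fE; rewrite -subr_ge0 fE.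
by rewrite mulr_ge0 // subr_ge0 ltW.
Qed.

(** With [x = expR u], two instances of [1 + v <= expR v], at [(1 - p) * u] and at [- (p * u)], are
    added with weights [p] and [1 - p], so that the terms in [u] cancel. *)
Lemma powR_le_tangent1 p x : 0 <= p <= 1 -> 0 <= x ->
  x `^ p <= 1 + p * (x - 1).
Proof.
move=> /andP[p0 p1]; rewrite le0r => /predU1P[->|x0].
  have [->|pn0] := eqVneq p 0; first by rewrite powRr0; lra.
  by rewrite powR0 //; lra.
pose u := ln x; have xE : x = expR u by rewrite /u lnK.
rewrite xE -expRM mulrC; set e := expR (p * u).
have e0 : 0 < e by exact: expR_gt0.
have e1 : e * (1 + (1 - p) * u) <= expR u.
  have -> : expR u = e * expR ((1 - p) * u) by rewrite /e -expRD; congr expR; ring.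
  by rewrite ler_pM2l // expR_ge1Dx.
have e2 : e * (1 - p * u) <= 1.
  have ee : e * expR (- (p * u)) = 1 by rewrite /e -expRD subrr expR0.
  by rewrite -[leRHS]ee ler_pM2l // expR_ge1Dx.
have := lerD (ler_wpM2l p0 e1) (ler_wpM2l (_ : 0 <= 1 - p) e2).
by move=> /(_ _); rewrite subr_ge0 => /(_ p1); lra.
Qed.

Lemma powRN_ge_tangent1 q x : 0 <= q -> 0 < x -> 1 - q * (x - 1) <= x `^ (- q).
Proof.
move=> q0 x0; pose u := ln x; have xE : x = expR u by rewrite /u lnK.
have ux : u <= x - 1 by have := expR_ge1Dx u; rewrite -xE; lra.
rewrite [in leRHS]xE -expRM; apply: le_trans (expR_ge1Dx _).
by have := ler_wpM2l q0 ux; lra.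
Qed.

Lemma powR_ge_tangent1 q x : 1 <= q -> 0 <= x -> 1 + q * (x - 1) <= x `^ q.
Proof.
move=> q1 x0; have q0 : 0 < q by lra.
have := @powR_le_tangent1 q^-1 (x `^ q).
rewrite -powRrM mulfV ?gt_eqF // powRr1 // powR_ge0.
rewrite invr_ge0 (ltW q0) invf_le1 // q1 => /(_ isT isT).
rewrite -(ler_pM2l q0) mulrDr mulrA mulfV ?gt_eqF //; lra.
Qed.

(** The bound is affine in [l^-1] rather than in [l] because [l^-1] is what the Schur complement
    controls. It is the tangent of the power [- p], taken at [h / l]. *)
Lemma powR_lower_bound p h l : 0 <= p -> 0 < h -> 0 < l ->
  h `^ p * (p * (1 - h / l)) <= l `^ p - h `^ p.
Proof.
move=> p0 h0 l0.
have := powRN_ge_tangent1 p0 (divr_gt0 h0 l0).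
have -> : (h / l) `^ (- p) = l `^ p / h `^ p.
  rewrite powRN powRM ?invr_ge0 ?ltW // -(powR_inv1 (ltW l0)) -powRrM.
  by rewrite mulN1r powRN invfM invrK mulrC.
rewrite -(ler_pM2l (powR_gt0 p h0)) mulrCA mulfV ?gt_eqF ?powR_gt0 //; lra.
Qed.

(** Counterpart of [powR_lower_bound] for log-determinants, needed when [p = 0]. *)
Lemma ln_lower_bound h l : 0 < h -> 0 < l -> 1 - h / l <= ln l - ln h.
Proof.
move=> h0 l0; have hl := divr_gt0 h0 l0.
have : ln (h / l) <= h / l - 1.
  by have := expR_ge1Dx (ln (h / l)); rewrite lnK //; lra.
by rewrite ln_div ?posrE //; lra.
Qed.

(** To the left of 1 the second Taylor polynomial at 1 lies above the power: their difference is
    nondecreasing there and vanishes at 1. *)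
Lemma powR_le_quadratic p t : 0 <= p <= 1 -> 0 < t <= 1 ->
  t `^ p <= 1 + p * (t - 1) - p * (1 - p) / 2 * (t - 1) ^+ 2.
Proof.
move=> /andP[p0 p1] /andP[t0 t1]; set k := p * (1 - p) / 2.
pose f : R -> R := (@powR R ^~ p) - (cst (1 - p) + p \*: id - k \*: ((id - cst 1) ^+ 2)).
pose df x : R := p * x `^ (p - 1) - (p - 2 * k * (x - 1)).
have fdf x : t <= x <= 1 -> is_derive x 1 f (df x).
  move=> /andP[tx _]; have x0 : 0 < x by lra.
  have dp : is_derive x 1 (@powR R ^~ p) (p * x `^ (p - 1)) by exact: is_derive1_powR.
  apply: is_derive_eq; rewrite /df /= /GRing.scale /=.
  by rewrite !fctE expr1; ring.
have df0 x : t < x < 1 -> 0 <= df x.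
  move=> /andP[tx _]; have x0 : 0 < x by lra.
  have := @powRN_ge_tangent1 (1 - p) x; rewrite opprB subr_ge0 => /(_ p1 x0) x1.
  by have := ler_wpM2l p0 x1; rewrite /df /k; lra.
have := derive_ge0_le t1 fdf df0; rewrite /f /= !fctE /= /GRing.scale /= powR1.
lra.
Qed.

(** The quadratic term is divided by [t] because [(t - 1)^2 / t = t - 2 + t^-1] uses only weights
    whose traces can be estimated. For [t <= 1] the cubic term makes up for this division; for
    [t > 1] the bound is [t] times the quadratic one for [t^-1] and [1 - p]. *)
Lemma powR_le_cubic p t : 0 <= p <= 1 -> 0 < t ->
  t `^ p <= 1 + p * (t - 1) - p * (1 - p) / 2 * ((t - 1) ^+ 2 / t)
            + p * (1 - p) / 2 * (`|t - 1| ^+ 3 / t).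
Proof.
move=> p01 t0; set k := p * (1 - p) / 2.
have k0 : 0 <= k.
  by case/andP: p01 => p0 p1; rewrite divr_ge0 // mulr_ge0 // subr_ge0.
have [t1|t1] := leP t 1.
  apply: le_trans (powR_le_quadratic p01 _) _; first by rewrite t0.
  rewrite ler0_norm ?subr_le0 // -/k le_eqVlt; apply/orP; left; apply/eqP.
  by field; rewrite gt_eqF.
have q01 : 0 <= 1 - p <= 1 by lra.
have s01 : 0 < t^-1 <= 1 by rewrite invr_gt0 t0 invf_le1 // ltW.
have /(ler_wpM2l (ltW t0)) := powR_le_quadratic q01 s01.
have -> : t * t^-1 `^ (1 - p) = t `^ p.
  rewrite -(powR_inv1 (ltW t0)) -powRrM mulN1r opprB.
  rewrite powRB ?(gt_eqF t0) ?implybT //.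
  by rewrite powRr1 ?ltW // mulrCA mulfV ?mulr1 // gt_eqF.
move=> /le_trans; apply.
rewrite -[leLHS]addr0; apply: lerD.
  by rewrite le_eqVlt; apply/orP; left; apply/eqP; rewrite /k; field; rewrite gt_eqF.
by rewrite mulr_ge0 // divr_ge0 ?exprn_ge0 // ltW.
Qed.

Let powR_cross1_ge0 p x : 0 <= p <= 1 -> 1 <= x ->
  0 <= (1 - p) / 2 * ((x `^ p + 1) * (x - 1)) - x + x `^ p.
Proof.
move=> /andP[p0 p1] x1; pose c := (1 - p) / 2.
pose f : R -> R := c \*: ((@powR R ^~ p + cst 1) * (id - cst 1)) - id + (@powR R ^~ p).
pose df y : R := c * (p * y `^ (p - 1) * (y - 1) + (y `^ p + 1)) - 1 + p * y `^ (p - 1).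
have fdf y : 1 <= y <= x -> is_derive y 1 f (df y).
  move=> /andP[y1 _]; have y0 : 0 < y by lra.
  have dp : is_derive y 1 (@powR R ^~ p) (p * y `^ (p - 1)) by exact: is_derive1_powR.
  apply: is_derive_eq; rewrite /df /= !fctE /= /GRing.scale /=; ring.
have df0 y : 1 < y < x -> 0 <= df y.
  move=> /andP[y1 _]; have y0 : 0 < y by lra.
  have ht : y `^ (1 - p) <= 1 + (1 - p) * (y - 1).
    by apply: powR_le_tangent1; [lra|rewrite ltW].
  have yp : y `^ (1 - p) * y `^ (p - 1) = 1.
    by rewrite -powRD ?subrKA ?subrr ?powRr0 // (gt_eqF y0) implybT.
  have yp1 : y `^ p = y * y `^ (p - 1).
    by rewrite powRB ?(gt_eqF y0) ?implybT // powRr1 1?ltW // mulrCA mulfV ?mulr1 ?gt_eqF.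
  have /(ler_wpM2r (powR_ge0 y (p - 1))) := ht; rewrite yp /df yp1 /c.
  (* [df y] is exactly [(1 + p) / 2] times the gap of the inequality on top of the goal. *)
  have p2 : 0 <= (1 + p) / 2 by lra.
  move=> /(ler_wpM2l p2); lra.
have := derive_ge0_le x1 fdf df0; rewrite /f /= !fctE /= /GRing.scale /= powR1 /c; lra.
Qed.

(** The inequality between pairs of eigenvalues behind the monotone gradient. Symmetry and
    homogeneity reduce it to the case [h = 1 <= l]. *)
Lemma powR_cross_ge0 p h l : 0 <= p <= 1 -> 0 < h -> 0 < l ->
  0 <= (l - h) * (l `^ p * h - h `^ p * l)
       + (1 - p) / 2 * ((l - h) ^+ 2 * (h `^ p + l `^ p)).
Proof.
move=> p01; wlog hl : h l / h <= l => [wl|] h0 l0.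
  have [/wl -> //|/ltW/wl wl'] := leP h l.
  by apply: le_trans (wl' l0 h0) _; rewrite le_eqVlt; apply/orP; left; apply/eqP; ring.
have x1 : 1 <= l / h by rewrite ler_pdivlMr // mul1r.
have := powR_cross1_ge0 p01 x1; set x := l / h in x1 *.
have -> : l = x * h by rewrite /x divfK ?gt_eqF.
rewrite powRM ?(ltW h0) //; last by lra.
set a := x `^ p; set b := h `^ p => H.
have : 0 <= (x - 1) * h ^+ 2 * b * ((1 - p) / 2 * ((a + 1) * (x - 1)) - x + a).
  by apply: mulr_ge0 => //; rewrite !mulr_ge0 ?powR_ge0 ?subr_ge0 // ltW.
lra.
Qed.

Lemma powRD_le p x t : 0 < p <= 1 -> 0 <= x -> 0 <= t ->
  (x + t) `^ p <= x `^ p + t `^ p.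
Proof.
move=> /andP[p0 p1] x0 t0.
have [->|x0'] := eqVneq x 0; first by rewrite add0r lerDr powR_ge0.
have [->|t0'] := eqVneq t 0; first by rewrite addr0 lerDl powR_ge0.
have xp : 0 < x by rewrite lt0r x0'.
have tp : 0 < t by rewrite lt0r t0'.
have sp : 0 < x + t by rewrite addr_gt0.
have ge y : 0 < y -> y <= x + t -> y / (x + t) * (x + t) `^ p <= y `^ p.
  move=> y0 yl; have -> : y `^ p = (y / (x + t)) `^ p * (x + t) `^ p.
    by rewrite -powRM ?divfK ?gt_eqF // ?divr_ge0 ?ltW.
  rewrite ler_pM2r ?powR_gt0 // ger1_powR //.
  by rewrite divr_gt0 // ler_pdivrMr // mul1r.
have xs : x <= x + t by rewrite lerDl.
have ts : t <= x + t by rewrite lerDr.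
apply: le_trans (lerD (ge x xp xs) (ge t tp ts)).
by rewrite -mulrDl -mulrDl mulfV ?mul1r ?gt_eqF.
Qed.

Lemma powR_jensen (I : finType) p (c h : I -> R) : 0 < p <= 1 ->
  (forall i, 0 <= c i) -> \sum_i c i = 1 -> (forall i, 0 <= h i) ->
  \sum_i c i * h i `^ p <= (\sum_i c i * h i) `^ p.
Proof.
move=> /andP[p0 p1] c0 c1 h0; set mu := \sum_i c i * h i.
have ch i : 0 <= c i * h i by rewrite mulr_ge0.
have : 0 <= mu by rewrite sumr_ge0.
rewrite le0r => /predU1P[mu0|mu0].
  rewrite big1 ?powR_ge0 // => i _.
  have /eqP := mu0; rewrite psumr_eq0 // => /allP /(_ i (mem_index_enum _)) /=.
  by rewrite mulf_eq0 => /orP[]/eqP ->; rewrite ?mul0r // powR0 ?mulr0 // gt_eqF.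
have tg i : c i * h i `^ p <= mu `^ p * (c i * (1 - p) + p / mu * (c i * h i)).
  have -> : h i `^ p = mu `^ p * (h i / mu) `^ p.
    rewrite -powRM; [by rewrite mulrC divfK // gt_eqF|exact: ltW|].
    by rewrite divr_ge0 // ltW.
  rewrite mulrCA ler_wpM2l ?powR_ge0 //.
  have : (h i / mu) `^ p <= 1 + p * (h i / mu - 1).
    by apply: powR_le_tangent1; [rewrite ltW|rewrite divr_ge0 // ltW].
  by move=> /(ler_wpM2l (c0 i)); lra.
apply: le_trans (ler_sum _ (fun i _ => tg i)) _.
rewrite -mulr_sumr big_split /= -mulr_suml -mulr_sumr c1 -/mu divfK ?gt_eqF //.
by rewrite mul1r subrK mulr1.
Qed.

End Scalar.

(** * Spectral theorem for real symmetric matrices *)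

Section Spectral.
Variable R : rcfType.

(** The Hermitian spectral theorem over the complex extension provides a real eigenvalue, and being
    an eigenvalue does not depend on the field, so an eigenvector exists over [R]. *)
Lemma symmetric_eigenvector m (H : 'M[R]_m.+1) : H^T = H ->
  exists a (v : 'rV_m.+1), v != 0 /\ v *m H = a *: v.
Proof.
move=> Hsym; pose HC := map_mx (real_complex R) H.
have HCherm : HC \is hermsymmx.
  apply: realsym_hermsym.
    apply/is_hermitianmxP; rewrite expr0 scale1r.
    by apply/matrixP => i j; rewrite /HC -[in LHS]Hsym !mxE.
  by apply/mxOverP => i j; rewrite mxE; apply/complex_realP; exists (H i j).
have dreal := hermitian_spectral_diag_real HCherm.
have /orthomx_spectralP HCE := hermitian_normalmx HCherm.
set d := spectral_diag HC in dreal HCE; set P := spectralmx HC in HCE.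
have Pu : P \in unitmx by exact: spectral_unit.
have /complex_realP [a da] := mxOverP dreal 0 0.
have : eigenvalue HC (real_complex R a).
  apply/eigenvalueP; exists (row 0 P); last first.
    apply/negP => /eqP P0; have : row 0 (P *m invmx P) = 0.
      by rewrite row_mul P0 mul0mx.
    rewrite mulmxV // => /rowP /(_ 0) /eqP.
    by rewrite !mxE eqxx oner_eq0.
  rewrite -row_mul [in LHS]HCE !mulmxA mulmxV // mul1mx.
  by apply/rowP => j; rewrite mxE mul_diag_mx !mxE da.
rewrite eigenvalue_map => /eigenvalueP [v vH v0].
by exists a, v.
Qed.

Lemma row_mul_trE n (u v : 'rV[R]_n) : (u *m v^T) 0 0 = \sum_k u 0 k * v 0 k.
Proof. by rewrite mxE; apply: eq_bigr => k _; rewrite mxE. Qed.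

Lemma row_self_gt0 n (v : 'rV[R]_n) : v != 0 -> 0 < (v *m v^T) 0 0.
Proof.
move=> v0; rewrite row_mul_trE lt0r sumr_ge0 ?andbT; last first.
  by move=> i _; rewrite -expr2 sqr_ge0.
apply: contra v0; rewrite psumr_eq0; last by move=> i _; rewrite -expr2 sqr_ge0.
move=> /allP v0; apply/eqP/rowP => j; apply/eqP.
by have := v0 j (mem_index_enum _); rewrite /= mulf_eq0 orbb mxE.
Qed.

(* Householder reflection *)
Lemma orthogonal_row0 m (v : 'rV[R]_m.+1) : v *m v^T = 1%:M ->
  exists2 Q : 'M_m.+1, Q *m Q^T = 1%:M & row 0 Q = v.
Proof.
move=> v1; pose e : 'rV[R]_m.+1 := delta_mx 0 0.
have [ve|ve] := eqVneq e v.
  exists 1%:M; first by rewrite trmx1 mulmx1.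
  by rewrite row1.
pose w := e - v; have w0 : w != 0 by rewrite subr_eq0.
have := row_self_gt0 w0; set b := (w *m w^T) 0 0 => b0.
have wwb : w *m w^T = b%:M by rewrite [LHS]mx11_scalar.
have ee : e *m e^T = 1%:M.
  by rewrite trmx_delta mul_delta_mx; apply/matrixP => i j; rewrite !ord1 !mxE.
have ew : e *m w^T = (b / 2)%:M.
  have bE : b%:M = 1%:M - e *m v^T - (e *m v^T)^T + 1%:M :> 'M[R]_1.
    rewrite -wwb /w linearB /= mulmxBl !mulmxBr ee v1 trmx_mul trmxK.
    by rewrite opprB addrA -!addrA; congr (_ + _); rewrite addrCA addrC -!addrA.
  rewrite /w linearB /= mulmxBr ee.
  have /matrixP/(_ 0 0) := bE; rewrite [e *m v^T]mx11_scalar.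
  set c := (e *m v^T) 0 0; rewrite !mxE /= !mulr1n => ->.
  apply/matrixP => i j; rewrite !ord1 !mxE /= !mulr1n.
  by field.
pose Q := 1%:M - (2 / b) *: (w^T *m w).
have QT : Q^T = Q by rewrite /Q linearB /= trmx1 linearZ /= trmx_mul trmxK.
have b1 : b != 0 by rewrite gt_eqF.
exists Q.
  rewrite QT /Q mulmxBr mulmx1 mulmxBl mul1mx -scalemxAl -scalemxAr.
  rewrite -mulmxA (mulmxA w) wwb mul_scalar_mx -scalemxAr !scalerA.
  rewrite opprB -addrA -[RHS]addr0; congr (_ + _).
  apply/matrixP => i j; rewrite !mxE; set x := \sum_(_ | _) _.
  by field; rewrite ?b1.
rewrite rowE -/e /Q mulmxBr mulmx1 -scalemxAr mulmxA ew mul_scalar_mx scalerA.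
have -> : 2 / b * (b / 2) = 1 by field.
by rewrite scale1r /w opprB addrC subrK.
Qed.

(** Deflation: in an orthonormal basis that starts with a unit eigenvector the matrix is block
    diagonal, and the induction hypothesis diagonalizes the remaining block. *)
Theorem symmetric_spectral m (H : 'M[R]_m) : H^T = H ->
  exists U (h : 'rV_m), U *m U^T = 1%:M /\ H = U^T *m diag_mx h *m U.
Proof.
elim: m H => [H _|m IHm]; last rewrite -[m.+1]/(1 + m)%N => H Hsym.
  by exists 1%:M, 0; split; apply/matrixP => -[[]].
have [a [v0 [v0n v0H]]] := symmetric_eigenvector Hsym.
pose c := (v0 *m v0^T) 0 0; have c0 : 0 < c by exact: row_self_gt0.
pose v := (Num.sqrt c)^-1 *: v0.
have vH : v *m H = a *: v by rewrite -scalemxAl v0H !scalerA mulrC.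
have v1 : v *m v^T = 1%:M.
  rewrite /v linearZ /= -scalemxAl -scalemxAr scalerA -invfM -expr2.
  rewrite sqr_sqrtr ?ltW // [v0 *m _]mx11_scalar -/c scale_scalar_mx mulVf //.
  by rewrite gt_eqF.
have [Q QQ Q0] := orthogonal_row0 v1.
have QQ' := mulmx1C QQ.
have [K KQ] : exists K : 'M_(1 + m), K = Q *m H *m Q^T by eexists.
have KT : K^T = K by rewrite KQ !trmx_mul trmxK Hsym mulmxA.
have K0 j : K 0 j = a * (j == 0)%:R.
  have <- : row 0 K 0 j = K 0 j by rewrite mxE.
  rewrite KQ !row_mul Q0 vH -scalemxAl -Q0 -row_mul QQ !mxE.
  by rewrite (eq_sym j).
have KE : K = block_mx a%:M 0 0 (drsubmx K).
  rewrite -[LHS]submxK; congr block_mx.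
  - apply/matrixP => i j; rewrite !ord1 !mxE !lshift0 K0.
    by rewrite mulr1.
  - apply/matrixP => i j; rewrite !ord1 !mxE lshift0 K0.
    by rewrite (_ : (_ == _) = false) ?mulr0.
  - apply/matrixP => i j; rewrite !ord1 !mxE lshift0 -KT mxE K0.
    by rewrite (_ : (_ == _) = false) ?mulr0.
have K'T : (drsubmx K)^T = drsubmx K by rewrite -[in RHS]KT trmx_drsub.
have [V [d [VV dE]]] := IHm _ K'T.
pose W : 'M_(1 + m) := block_mx 1%:M 0 0 V.
have WW : W *m W^T = 1%:M.
  rewrite /W tr_block_mx mulmx_block !trmx0 trmx1 !mulmx0 !mul0mx.
  by rewrite !addr0 add0r mulmx1 VV -scalar_mx_block.
exists (W *m Q), (row_mx a%:M d); split.
  by rewrite trmx_mul mulmxA -(mulmxA W) QQ mulmx1.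
have -> : H = Q^T *m K *m Q.
  by rewrite KQ !mulmxA QQ' mul1mx -mulmxA QQ' mulmx1.
rewrite trmx_mul !mulmxA; congr (_ *m _); rewrite -!mulmxA; congr (_ *m _).
rewrite KE dE diag_mx_row /W tr_block_mx !trmx0 trmx1 !mulmx_block.
rewrite !mulmx0 !mul0mx !mul1mx !mulmx1 !add0r !addr0 mulmx0 ?mulmxA.
have -> // : diag_mx (a%:M : 'rV_1) = a%:M.
by apply/matrixP => i j; rewrite !ord1 !mxE eqxx.
Qed.

End Spectral.

(** * Quadratic forms in two eigenbases *)

Section QuadraticForm.
Variables (R : realType) (n : nat).
Implicit Types (E H L U V : 'M[R]_n) (u v z h l : 'rV[R]_n).

Definition qf E u : R := (u *m E *m u^T) 0 0.

(** The eigenvectors are the rows of [U]. No sign is imposed on [h]. *)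
Definition eigdec H U h := U *m U^T = 1%:M /\ H = U^T *m diag_mx h *m U.

Lemma qf_sum (I : finType) (x : I -> R) (E : I -> 'M[R]_n) u :
  qf (\sum_i x i *: E i) u = \sum_i x i * qf (E i) u.
Proof.
rewrite /qf mulmx_sumr mulmx_suml summxE; apply: eq_bigr => i _.
by rewrite -scalemxAr -scalemxAl mxE.
Qed.

Lemma qfD E E' u : qf (E + E') u = qf E u + qf E' u.
Proof. by rewrite /qf mulmxDr mulmxDl mxE. Qed.

Lemma qfZ x E u : qf (x *: E) u = x * qf E u.
Proof. by rewrite /qf -scalemxAr -scalemxAl mxE. Qed.

Lemma qf_subZ E a u z : qf E (a *: u - z) =
  a ^+ 2 * qf E u - a * ((u *m E *m z^T) 0 0 + (z *m E *m u^T) 0 0) + qf E z.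
Proof.
rewrite /qf linearB /= linearZ /= !mulmxBl !mulmxBr -!scalemxAl -!scalemxAr.
by rewrite !mxE; ring.
Qed.

Lemma bilin_diag_mx u z h :
  (u *m diag_mx h *m z^T) 0 0 = \sum_k h 0 k * (u 0 k * z 0 k).
Proof. by rewrite mul_mx_diag mxE; apply: eq_bigr => k _; rewrite !mxE; ring. Qed.

Lemma eigdec_bilin H U h u z : eigdec H U h ->
  (u *m H *m z^T) 0 0 = \sum_k h 0 k * ((u *m U^T) 0 k * (z *m U^T) 0 k).
Proof.
move=> [_ ->]; rewrite -bilin_diag_mx !trmx_mul trmxK.
by rewrite -!mulmxA.
Qed.

Lemma eigdec_qf H U h u : eigdec H U h ->
  qf H u = \sum_k h 0 k * ((u *m U^T) 0 k) ^+ 2.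
Proof. by move=> dec; rewrite /qf (eigdec_bilin _ _ dec). Qed.

Lemma eigdec_qf_row H U h V j : eigdec H U h ->
  qf H (row j V) = \sum_k h 0 k * ((V *m U^T) j k) ^+ 2.
Proof.
move=> dec; rewrite (eigdec_qf _ dec); apply: eq_bigr => k _.
by rewrite -row_mul mxE.
Qed.

Lemma eigdec_qf_diag H U h j : eigdec H U h -> qf H (row j U) = h 0 j.
Proof.
move=> dec; rewrite (eigdec_qf_row _ _ dec); case: (dec) => -> _.
rewrite (bigD1 j) //= big1 => [|k kj]; rewrite !mxE ?eqxx ?expr1n ?mulr1 ?addr0 //.
by rewrite (eq_sym j) (negPf kj) expr0n mulr0.
Qed.

Lemma orthogonal_row_norm U u : U *m U^T = 1%:M ->
  \sum_k ((u *m U^T) 0 k) ^+ 2 = (u *m u^T) 0 0.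
Proof.
move=> UU; have -> : u *m u^T = (u *m U^T) *m (u *m U^T)^T.
  by rewrite trmx_mul trmxK -mulmxA (mulmxA _ U) (mulmx1C UU) mul1mx.
by rewrite row_mul_trE; apply: eq_bigr => k _; rewrite expr2.
Qed.

Lemma overlapC U V j k : (U *m V^T) j k = (V *m U^T) k j.
Proof. by rewrite -[U *m _]trmxK trmx_mul trmxK mxE. Qed.

(** Squared overlaps of two orthonormal bases form a doubly stochastic matrix, so spectral sums
    taken in the two bases can be merged into one sum over pairs of eigenvalues. *)
Lemma overlap_suml U V j : U *m U^T = 1%:M -> V *m V^T = 1%:M ->
  \sum_k ((U *m V^T) j k) ^+ 2 = 1.
Proof.
move=> UU VV; have : ((U *m V^T) *m (U *m V^T)^T) j j = 1.
  rewrite trmx_mul trmxK mulmxA -(mulmxA U) (mulmx1C VV) mulmx1 UU.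
  by rewrite mxE eqxx.
rewrite mxE => <-; apply: eq_bigr => k _.
by rewrite expr2 [_^T k j]mxE.
Qed.

Lemma overlap_sumr U V k : U *m U^T = 1%:M -> V *m V^T = 1%:M ->
  \sum_j ((U *m V^T) j k) ^+ 2 = 1.
Proof.
move=> UU VV; rewrite -[RHS](overlap_suml k VV UU).
by apply: eq_bigr => j _; rewrite overlapC.
Qed.

Lemma psd_eigdec H : psdmx H -> exists U h, eigdec H U h /\ forall j, 0 <= h 0 j.
Proof.
move=> [/is_hermitianmxP]; rewrite expr0 scale1r => Hsym Hpos.
have HT : H^T = H by rewrite [in RHS]Hsym; apply/matrixP => i j; rewrite !mxE.
have [U [h dec]] := symmetric_spectral HT.
exists U, h; split=> // j; rewrite -(eigdec_qf_diag j dec) /qf.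
by have := Hpos (row j U)^T; rewrite trmxK.
Qed.

Lemma psdmx_qf_ge0 H u : psdmx H -> 0 <= qf H u.
Proof. by case=> _ /(_ u^T); rewrite trmxK. Qed.

Lemma psdmx_sum (I : finType) (x : I -> R) (E : I -> 'M[R]_n) :
  (forall i, psdmx (E i)) -> (forall i, 0 <= x i) -> psdmx (\sum_i x i *: E i).
Proof.
move=> Epsd x0; split.
  apply/is_hermitianmxP; rewrite expr0 scale1r.
  apply/matrixP => j k; rewrite !mxE !summxE; apply: eq_bigr => i _.
  case: (Epsd i) => /is_hermitianmxP; rewrite expr0 scale1r => Ei _.
  by rewrite !mxE [in LHS]Ei !mxE.
move=> v; rewrite -[X in _ *m X]trmxK -/(qf _ _) qf_sum.
by rewrite sumr_ge0 // => i _; rewrite mulr_ge0 // psdmx_qf_ge0.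
Qed.

Lemma psdmxZ a E : 0 <= a -> psdmx E -> psdmx (a *: E).
Proof.
move=> a0 Epsd; have -> : a *: E = \sum_(i < 1) a *: E by rewrite big_ord1.
exact: psdmx_sum.
Qed.

(* [tr (H^a E)] when [eigdec H U h] *)
Definition trpowmul (U : 'M[R]_n) h a E : R := \sum_j h 0 j `^ a * qf E (row j U).

(** Each [qf H (row k V)] averages the eigenvalues of [H] with overlap weights; Jensen's inequality
    for the concave power does the rest. *)
Lemma peierls p H U h V : 0 < p <= 1 -> eigdec H U h -> (forall j, 0 <= h 0 j) ->
  V *m V^T = 1%:M -> \sum_j h 0 j `^ p <= \sum_k qf H (row k V) `^ p.
Proof.
move=> p01 dec h0 VV; have UU := dec.1.
have -> : \sum_j h 0 j `^ p = \sum_k \sum_j ((V *m U^T) k j) ^+ 2 * h 0 j `^ p.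
  rewrite exchange_big /=; apply: eq_bigr => j _.
  by rewrite -mulr_suml overlap_sumr // mul1r.
apply: ler_sum => k _; rewrite (eigdec_qf_row _ _ dec).
under [in leRHS]eq_bigr => j _ do rewrite mulrC.
by apply: powR_jensen => // [j|]; rewrite ?sqr_ge0 // overlap_suml.
Qed.

(** In the eigenbasis of [L], [peierls] reduces the comparison of traces to monotonicity of the
    scalar power on diagonal entries. *)
Lemma sum_powR_le p H U h L V l : 0 < p <= 1 ->
  eigdec H U h -> (forall j, 0 <= h 0 j) -> eigdec L V l ->
  (forall u, qf H u <= qf L u) -> \sum_j h 0 j `^ p <= \sum_k l 0 k `^ p.
Proof.
move=> p01 Hdec h0 Ldec HL; apply: le_trans (peierls p01 Hdec h0 Ldec.1) _.
apply: ler_sum => k _; rewrite -(eigdec_qf_diag k Ldec).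
have Hk : 0 <= qf H (row k V).
  by rewrite (eigdec_qf _ Hdec) sumr_ge0 // => j _; rewrite mulr_ge0 ?sqr_ge0.
rewrite ge0_ler_powR ?nnegrE //; first by case/andP: p01 => /ltW.
exact: le_trans (HL _).
Qed.

End QuadraticForm.

(** * Spectral estimates when the summands of a matrix are reweighted *)

Section Reweighting.
Variables (R : realType) (n : nat) (I : finType).
Variables (E : I -> 'M[R]_n) (t : I -> R) (H U L V : 'M[R]_n) (h l : 'rV[R]_n).
Hypothesis E_psd : forall i u, 0 <= qf (E i) u.
Hypothesis t_gt0 : forall i, 0 < t i.
Hypotheses (Hdec : eigdec H U h) (Ldec : eigdec L V l).
Hypotheses (h_gt0 : forall j, 0 < h 0 j) (l_gt0 : forall k, 0 < l 0 k).
Hypothesis HE : H = \sum_i E i.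
Hypothesis LE : L = \sum_i t i *: E i.

Local Notation c j k := (((U *m V^T) j k) ^+ 2).
Local Notation e p i := (trpowmul U h (p - 1) (E i)).

Lemma reweight_row_sum j : \sum_i qf (E i) (row j U) = h 0 j.
Proof.
rewrite -(eigdec_qf_diag j Hdec) HE.
under [in RHS]eq_bigr do rewrite -[E _]scale1r.
by rewrite qf_sum; apply: eq_bigr => i _; rewrite mul1r.
Qed.

Lemma reweight_row_sumM j :
  \sum_i t i * qf (E i) (row j U) = \sum_k c j k * l 0 k.
Proof.
rewrite -qf_sum -LE (eigdec_qf_row _ _ Ldec).
by apply: eq_bigr => k _; rewrite mulrC.
Qed.

(* [H L^-1 H <= \sum_i (t i)^-1 E i], a Schur complement, tested on [row j U]. *)
Lemma reweight_row_sumV j :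
  \sum_k c j k * (h 0 j ^+ 2 / l 0 k) <= \sum_i (t i)^-1 * qf (E i) (row j U).
Proof.
set u := row j U; set D := leLHS.
(* These are the coordinates in the basis [V] of [u H L^-1], the vector [z] that minimizes the sum
   shown nonnegative in [pos]. *)
pose zeta := \row_k (h 0 j * (U *m V^T) j k / l 0 k).
pose z := zeta *m V.
have zV : z *m V^T = zeta by rewrite /z -mulmxA Ldec.1 mulmx1.
have Lz : qf L z = D.
  rewrite (eigdec_qf _ Ldec) zV; apply: eq_bigr => k _; rewrite mxE.
  by field; rewrite gt_eqF.
have uU : u *m U^T = delta_mx 0 j by rewrite -row_mul Hdec.1 row1.
have zUj : (z *m U^T) 0 j = \sum_k zeta 0 k * (U *m V^T) j k.
  rewrite -mulmxA mxE; apply: eq_bigr => k _.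
  by rewrite (overlapC U V).
have uHz : (u *m H *m z^T) 0 0 = D.
  rewrite (eigdec_bilin _ _ Hdec) uU (bigD1 j) //= big1 ?addr0; last first.
    by move=> k kj; rewrite mxE (negPf kj) andbF mul0r mulr0.
  rewrite mxE !eqxx mul1r zUj mulr_sumr; apply: eq_bigr => k _; rewrite mxE.
  by ring.
have zHu : (z *m H *m u^T) 0 0 = D.
  rewrite -uHz !(eigdec_bilin _ _ Hdec).
  by apply: eq_bigr => k _; congr (_ * _); exact: mulrC.
have pos : 0 <= \sum_i t i * qf (E i) ((t i)^-1 *: u - z).
  by rewrite sumr_ge0 // => i _; rewrite mulr_ge0 // ltW.
have HEb v w : (v *m H *m w^T) 0 0 = \sum_i (v *m E i *m w^T) 0 0.
  by rewrite HE mulmx_sumr mulmx_suml summxE.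
rewrite -subr_ge0; apply: le_trans pos _.
have -> : \sum_i t i * qf (E i) ((t i)^-1 *: u - z) =
   \sum_i (t i)^-1 * qf (E i) u - ((u *m H *m z^T) 0 0 + (z *m H *m u^T) 0 0)
   + qf L z.
  rewrite LE qf_sum !HEb -big_split -sumrB -big_split /=.
  apply: eq_bigr => i _; rewrite qf_subZ.
  by field; rewrite gt_eqF.
by rewrite uHz zHu Lz; lra.
Qed.

Lemma reweight_sum p : \sum_i e p i = \sum_j h 0 j `^ p.
Proof.
rewrite exchange_big /=; apply: eq_bigr => j _; rewrite -mulr_sumr reweight_row_sum.
by rewrite powRB ?(gt_eqF (h_gt0 _)) ?implybT // powRr1 ?ltW // divfK ?gt_eqF.
Qed.

Lemma reweight_sumM p :
  \sum_i t i * e p i = \sum_j \sum_k c j k * (h 0 j `^ (p - 1) * l 0 k).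
Proof.
under eq_bigr do rewrite mulr_sumr.
rewrite exchange_big /=; apply: eq_bigr => j _.
under eq_bigr do rewrite mulrCA.
rewrite -mulr_sumr reweight_row_sumM mulr_sumr.
by apply: eq_bigr => k _; exact: mulrCA.
Qed.

Lemma reweight_sumV p :
  \sum_j \sum_k c j k * (h 0 j `^ (p - 1) * (h 0 j ^+ 2 / l 0 k))
    <= \sum_i (t i)^-1 * e p i.
Proof.
under [leRHS]eq_bigr do rewrite mulr_sumr.
rewrite [leRHS]exchange_big /=; apply: ler_sum => j _.
under [leRHS]eq_bigr do rewrite mulrCA.
rewrite -mulr_sumr; under eq_bigr do rewrite mulrCA.
by rewrite -mulr_sumr ler_wpM2l ?powR_ge0 // reweight_row_sumV.
Qed.

Lemma overlap_sum_h (f : R -> R) : \sum_j f (h 0 j) = \sum_j \sum_k c j k * f (h 0 j).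
Proof.
apply: eq_bigr => j _; rewrite -mulr_suml overlap_suml ?mul1r //.
  exact: Hdec.1.
exact: Ldec.1.
Qed.

Lemma overlap_sum_l (f : R -> R) : \sum_k f (l 0 k) = \sum_j \sum_k c j k * f (l 0 k).
Proof.
rewrite exchange_big /=; apply: eq_bigr => k _.
rewrite -mulr_suml overlap_sumr ?mul1r //.
  exact: Hdec.1.
exact: Ldec.1.
Qed.

(** Used for [f] the power [p] with [b = p], and for [f = ln] with [b = 1] and [p = 0]. After
    [reweight_sumV] both sides are double sums with the same overlap weights, and the hypothesis on
    [f] compares them term by term. *)
Lemma spectral_sum_lower_bound p b (f : R -> R) : 0 <= b ->
  (forall x y, 0 < x -> 0 < y -> x `^ p * (b * (1 - x / y)) <= f y - f x) ->
  b * \sum_i (1 - (t i)^-1) * e p i <= \sum_k f (l 0 k) - \sum_j f (h 0 j).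
Proof.
move=> b0 fb.
under eq_bigr do rewrite mulrBl mul1r.
rewrite sumrB reweight_sum overlap_sum_h overlap_sum_l (overlap_sum_h (@powR R ^~ p)).
apply: le_trans (_ : b * (\sum_j \sum_k c j k * h 0 j `^ p -
   \sum_j \sum_k c j k * (h 0 j `^ (p - 1) * (h 0 j ^+ 2 / l 0 k))) <= _).
  by rewrite ler_wpM2l // lerB // reweight_sumV.
rewrite -!sumrB mulr_sumr; apply: ler_sum => j _.
rewrite -!sumrB mulr_sumr; apply: ler_sum => k _.
rewrite -!mulrBr mulrCA ler_wpM2l ?sqr_ge0 //.
apply: le_trans (fb _ _ (h_gt0 j) (l_gt0 k)).
rewrite powRB ?(gt_eqF (h_gt0 _)) ?implybT // (powRr1 (ltW (h_gt0 j))).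
by rewrite le_eqVlt; apply/orP; left; apply/eqP; field; rewrite !gt_eqF.
Qed.

(* The contribution of eigenvalues [x] of [H] and [y] of [L] to the lower bound
   of [tr L^p - \sum_i t_i^p tr (E_i H^(p-1))] that results from
   [powR_le_cubic]. *)
Definition stepdefect p (x y : R) : R :=
  y `^ p - x `^ p - p * (x `^ (p - 1) * y - x `^ p)
  + p * (1 - p) / 2 * (x `^ (p - 1) * y - 2 * x `^ p + x `^ (p - 1) * (x ^+ 2 / y)).

(** [powR_le_cubic] bounds the powers of [t i] by combinations of 1, [t i] and its inverse, plus a
    remainder. The inverse has a nonpositive coefficient, so the lower bound [reweight_sumV] acts in
    the right direction. *)
Lemma step_lower_bound p : 0 <= p <= 1 ->
  \sum_j \sum_k c j k * stepdefect p (h 0 j) (l 0 k)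
  - p * (1 - p) / 2 * \sum_i `|t i - 1| ^+ 3 / t i * e p i
  <= \sum_k l 0 k `^ p - \sum_i t i `^ p * e p i.
Proof.
move=> p01; set kp := p * (1 - p) / 2.
have kp0 : 0 <= kp.
  by case/andP: p01 => p0 p1; rewrite divr_ge0 // mulr_ge0 // subr_ge0.
have e0 i : 0 <= e p i.
  by rewrite sumr_ge0 // => j _; rewrite mulr_ge0 ?powR_ge0.
have tp : \sum_i t i `^ p * e p i <= (1 - p + 2 * kp) * \sum_i e p i
   + (p - kp) * \sum_i t i * e p i - kp * \sum_i (t i)^-1 * e p i
   + kp * \sum_i `|t i - 1| ^+ 3 / t i * e p i.
  rewrite !mulr_sumr -big_split -sumrB -big_split /=; apply: ler_sum => i _.
  have := ler_wpM2r (e0 i) (powR_le_cubic p01 (t_gt0 i)); rewrite -/kp.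
  move=> /le_trans; apply; rewrite le_eqVlt; apply/orP; left; apply/eqP.
  by field; rewrite gt_eqF.
have := ler_wpM2l kp0 (reweight_sumV p).
move: tp; rewrite reweight_sum reweight_sumM.
rewrite (overlap_sum_h (@powR R ^~ p)) (overlap_sum_l (@powR R ^~ p)).
set S1 := \sum_i t i `^ p * _; set S2 := \sum_i (t i)^-1 * _.
set S3 := \sum_i `|_| ^+ 3 / _ * _; set S4 := \sum_j \sum_k c j k * h 0 j `^ p.
set S5 := \sum_j \sum_k c j k * (_ * l 0 k).
set S6 := \sum_j \sum_k c j k * (_ * (_ / _)).
set S7 := \sum_j \sum_k c j k * l 0 k `^ p.
suff -> : \sum_j \sum_k c j k * stepdefect p (h 0 j) (l 0 k) =
   S7 - S4 - p * (S5 - S4) + kp * (S5 - 2 * S4 + S6) by lra.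
rewrite /S4 /S5 /S6 /S7 !(mulr_sumr, =^~ big_split, =^~ sumrB) /=.
apply: eq_bigr => j _.
rewrite !(mulr_sumr, =^~ big_split, =^~ sumrB) /=.
by apply: eq_bigr => k _; rewrite /stepdefect -/kp; ring.
Qed.

End Reweighting.

(** The sum equals [p / (x * y)] times the expression in [powR_cross_ge0]. *)
Lemma stepdefect_sym_ge0 (R : realType) (p x y : R) : 0 <= p <= 1 ->
  0 < x -> 0 < y -> 0 <= stepdefect p x y + stepdefect p y x.
Proof.
move=> p01 x0 y0; have := powR_cross_ge0 p01 x0 y0.
have p0 : 0 <= p / (x * y) by rewrite divr_ge0 ?(ltW (mulr_gt0 x0 y0)) //; case/andP: p01.
move=> /(mulr_ge0 p0) /le_trans; apply; rewrite le_eqVlt; apply/orP; left.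
apply/eqP; rewrite /stepdefect !powRB ?(gt_eqF x0) ?(gt_eqF y0) ?implybT //.
rewrite (powRr1 (ltW x0)) (powRr1 (ltW y0)); set a := x `^ p; set b := y `^ p.
by field; rewrite !gt_eqF.
Qed.

(** * Convexity along a segment *)

Lemma ge0_of_le_divn (R : realType) (a b : R) (n0 : nat) : 0 <= b ->
  (forall n, (n0 < n)%N -> - b / n%:R <= a) -> 0 <= a.
Proof.
move=> b0 ab; rewrite leNgt; apply/negP => a0.
pose n := (maxn n0.+1 (Num.bound (b / - a))).
have n1 : (n0 < n)%N by rewrite /n leq_maxl.
have nb : b / - a < n%:R.
  apply: lt_le_trans (_ : (Num.bound (b / - a))%:R <= _).
    by rewrite archi_boundP // divr_ge0 // oppr_ge0 ltW.
  by rewrite ler_nat leq_maxr.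
have n0' : 0 < n%:R :> R by rewrite ltr0n (leq_trans _ n1).
have := ab n n1; rewrite ler_pdivrMr // leNgt => /negP; apply.
by move: nb; rewrite ltr_pdivrMr ?oppr_gt0 //; lra.
Qed.

(** Over [n] equal steps the losses add up to [n * C * (b / n)^2 = C * b^2 / n], which tends to 0.
    Neither continuity nor a derivative of [f] is involved. *)
Lemma le_of_quadratic_loss (R : realType) (f : R -> R) (C d b : R) :
  0 <= C -> 0 < d -> 0 <= b <= 1 ->
  (forall s s', 0 <= s -> s <= s' -> s' <= 1 -> s' - s <= d ->
     f s - C * (s' - s) ^+ 2 <= f s') ->
  f 0 <= f b.
Proof.
move=> C0 d0 /andP[b0 b1] fC; rewrite -subr_ge0.
apply: (@ge0_of_le_divn _ _ (C * b ^+ 2) (Num.bound (b / d))) => [|n nb].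
  by rewrite mulr_ge0 ?sqr_ge0.
have n0 : 0 < n%:R :> R by rewrite ltr0n (leq_trans _ nb).
have nb' : b / n%:R <= d.
  rewrite ler_pdivrMr // -ler_pdivrMl // mulrC ltW //.
  apply: lt_trans (_ : (Num.bound (b / d))%:R < _); last by rewrite ltr_nat.
  by rewrite archi_boundP // divr_ge0 // ltW.
have key k : (k <= n)%N -> f 0 - k%:R * (C * (b / n%:R) ^+ 2) <= f (k%:R * (b / n%:R)).
  elim: k => [_|k IHk kn]; first by rewrite !mul0r subr0.
  have bn0 : 0 <= b / n%:R by rewrite divr_ge0 // ltW.
  have kS : k.+1%:R * (b / n%:R) - k%:R * (b / n%:R) = b / n%:R.
    by rewrite -mulrBl -natrB // subSnn mul1r.
  have := @fC (k%:R * (b / n%:R)) (k.+1%:R * (b / n%:R)); rewrite kS.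
  move=> /(_ _ _ _ nb') fk; apply: le_trans (fk _ _ _).
  - rewrite -natr1 mulrDl; have := IHk (ltnW kn); lra.
  - by rewrite mulr_ge0.
  - by rewrite ler_wpM2r // ler_nat.
  - rewrite mulrCA; apply: le_trans b1.
    by rewrite ler_piMr // ler_pdivrMr // mul1r ler_nat.
have := key n (leqnn n).
have -> : n%:R * (b / n%:R) = b by rewrite mulrCA mulfV ?mulr1 ?gt_eqF.
have -> : n%:R * (C * (b / n%:R) ^+ 2) = C * b ^+ 2 / n%:R.
  by field; rewrite gt_eqF.
lra.
Qed.

(** Bernoulli's inequality at [y] and at [y^-1] bounds the power from below and from above, as the
    two powers have product 1. *)
Lemma powR_near1 (R : realType) (q y : R) : 1 <= q -> `|y - 1| * (4 * q) <= 1 ->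
  [/\ `|y `^ q - 1| <= 4 * q * `|y - 1|, 2^-1 <= y `^ q & y `^ q <= 2].
Proof.
move=> q1 yq; set u := `|y - 1| in yq *.
have u0 : 0 <= u by exact: normr_ge0.
have u4 : u * 4 <= 1 by have := ler_wpM2l u0 q1; lra.
have [yl yu] : - u <= y - 1 /\ y - 1 <= u.
  by apply/andP; rewrite -ler_norml.
have y0 : 0 < y by lra.
have qu0 : 0 <= q * u by rewrite mulr_ge0 //; lra.
have lo := powR_ge_tangent1 q1 (ltW y0).
have yi0 : 0 <= y^-1 by rewrite invr_ge0 ltW.
have hi := powR_ge_tangent1 q1 yi0.
have yv : y * y^-1 = 1 by rewrite mulfV // gt_eqF.
have yi2 : y^-1 <= 2.
  by rewrite -[leRHS]invrK lef_pV2 ?posrE //; lra.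
have yi : - (2 * u) <= y^-1 - 1.
  have : (y - 1) * y^-1 <= u * y^-1 by rewrite ler_wpM2r.
  have : u * y^-1 <= u * 2 by rewrite ler_wpM2l.
  by rewrite mulrBl yv mul1r; lra.
have tv : y `^ q * y^-1 `^ q = 1.
  by rewrite -powRM ?yv ?powR1 // ltW.
set t := y `^ q in lo tv *.
have t0 : 0 < t by rewrite powR_gt0.
have lo' : - (q * u) <= t - 1.
  by have := ler_wpM2l (_ : 0 <= q) yl; move=> /(_ _); lra.
have hi' : 1 - 2 * (q * u) <= y^-1 `^ q.
  by have := ler_wpM2l (_ : 0 <= q) yi; move=> /(_ _); lra.
have t1 : t * (1 - 2 * (q * u)) <= 1 by rewrite -[leRHS]tv ler_wpM2l // ltW.
have t2 : t <= 2.
  have : t * 2^-1 <= t * (1 - 2 * (q * u)) by apply: ler_wpM2l; lra.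
  lra.
have t3 : t * (q * u) <= 2 * (q * u) by rewrite ler_wpM2r.
split; [|lra|lra].
by rewrite ler_norml; apply/andP; split; lra.
Qed.

Section MorePositivity.
Variables (R : realType) (n : nat).
Implicit Types (H L U V : 'M[R]_n) (h l : 'rV[R]_n).

Lemma eigdecZ H U h a : eigdec H U h -> eigdec (a *: H) U (a *: h).
Proof.
move=> [UU ->]; split=> //.
have -> : diag_mx (a *: h) = a *: diag_mx h by rewrite linearZ.
by rewrite -scalemxAr -scalemxAl.
Qed.

Lemma eigdec_qf_gt0 H U h V k : eigdec H U h -> (forall j, 0 < h 0 j) ->
  V *m V^T = 1%:M -> 0 < qf H (row k V).
Proof.
move=> dec h0 VV; rewrite (eigdec_qf_row _ _ dec) lt0r sumr_ge0 ?andbT; last first.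
  by move=> j _; rewrite mulr_ge0 ?sqr_ge0 // ltW.
apply/eqP => s0; have := overlap_suml k VV dec.1.
rewrite big1 => [/eqP|j _]; first by rewrite eq_sym oner_eq0.
have /eqP := s0; rewrite psumr_eq0 => [/allP /(_ j (mem_index_enum _))|i _]; last first.
  by rewrite mulr_ge0 ?sqr_ge0 // ltW.
by rewrite /= mulf_eq0 gt_eqF //= => /eqP.
Qed.

Lemma trpowmulZ U h a x (E : 'M[R]_n) :
  trpowmul U h a (x *: E) = x * trpowmul U h a E.
Proof.
by rewrite /trpowmul mulr_sumr; apply: eq_bigr => j _; rewrite qfZ mulrCA.
Qed.

Lemma trpowmul_ge0 U h a E : psdmx E -> 0 <= trpowmul U h a E.
Proof.
by move=> Epsd; rewrite sumr_ge0 // => j _; rewrite mulr_ge0 ?powR_ge0 ?psdmx_qf_ge0.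
Qed.

End MorePositivity.

(** * The tangent inequality for the trace of a power *)

Section Path.
Variables (R : realType) (n : nat) (I : finType).
Variables (E : I -> 'M[R]_n) (r : I -> R) (p : R) (U : 'M[R]_n) (h : 'rV[R]_n).
Hypothesis E_psd : forall i, psdmx (E i).
Hypothesis r_gt0 : forall i, 0 < r i.
Hypotheses (p_gt0 : 0 < p) (p_le1 : p <= 1).
Hypothesis Hdec : eigdec (\sum_i E i) U h.
Hypothesis h_gt0 : forall j, 0 < h 0 j.

Let q := p^-1.
(* A segment in the coordinates in which the trace is convex. *)
Let y s i := 1 + s * (r i - 1).
Let Hs s := \sum_i y s i `^ q *: E i.

Let p01 : 0 <= p <= 1. Proof. by rewrite ltW. Qed.
Let q_ge1 : 1 <= q. Proof. by rewrite /q invf_ge1. Qed.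

(** Uniform bounds along the segment: [rho] is below 1 and every [r i], and [D] is above every
    [|r i - 1|]. Sums stand in for a minimum and a maximum. *)
Let rho := (1 + \sum_i (r i)^-1)^-1.
Let D := \sum_i `|r i - 1|.

Let sum_ge_term (f : I -> R) i : (forall j, 0 <= f j) -> f i <= \sum_j f j.
Proof. by move=> f0; rewrite (bigD1 i) //= lerDl sumr_ge0. Qed.

Let rinv0 : 0 <= \sum_i (r i)^-1.
Proof. by rewrite sumr_ge0 // => i _; rewrite invr_ge0 ltW. Qed.

Let rho_gt0 : 0 < rho. Proof. by rewrite invr_gt0; have := rinv0; lra. Qed.
Let rho_le1 : rho <= 1. Proof. by rewrite invf_le1; have := rinv0; lra. Qed.
Let rho_le i : rho <= r i.
Proof.
rewrite -[leRHS]invrK lef_pV2 ?posrE ?invr_gt0 //; last by have := rinv0; lra.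
have : (r i)^-1 <= \sum_i (r i)^-1.
  by apply: (@sum_ge_term (fun i => (r i)^-1)) => j; rewrite invr_ge0 ltW.
lra.
Qed.
Let D_ge0 : 0 <= D. Proof. by rewrite sumr_ge0. Qed.
Let D_ge i : `|r i - 1| <= D. Proof. exact: (@sum_ge_term (fun i => `|r i - 1|)). Qed.

Let y_ge s i : 0 <= s <= 1 -> rho <= y s i.
Proof.
move=> /andP[s0 s1]; have := rho_le i => ri; rewrite /y.
have : s * rho <= s * r i by rewrite ler_wpM2l.
have : (1 - s) * rho <= (1 - s) * 1 by rewrite ler_wpM2l // subr_ge0.
lra.
Qed.
Let y_gt0 s i : 0 <= s <= 1 -> 0 < y s i.
Proof. by move=> /(y_ge i); exact: lt_le_trans. Qed.
Let y_le s i : 0 <= s <= 1 -> y s i <= 1 + D.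
Proof.
move=> /andP[s0 s1]; rewrite /y lerD2l; apply: le_trans (D_ge i).
apply: le_trans (ler_norm _) _; rewrite normrM ger0_norm //.
by rewrite ler_piMl.
Qed.

(** The decompositions are chosen separately for each [s], without continuity; only the one at 0 is
    prescribed, since the final gradient is expressed in it. *)
Let path_eigdec : exists d : R -> 'M[R]_n * 'rV[R]_n,
  d 0 = (U, h) /\
  forall s, 0 <= s <= 1 -> eigdec (Hs s) (d s).1 (d s).2 /\ forall j, 0 < (d s).2 0 j.
Proof.
have /choice [d dP] : forall s, exists d : 'M[R]_n * 'rV[R]_n, (s = 0 -> d = (U, h)) /\
  (0 <= s <= 1 -> eigdec (Hs s) d.1 d.2 /\ forall j, 0 < d.2 0 j).
  move=> s; have [->|s0] := eqVneq s 0.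
    exists (U, h); split=> // _; split=> //=.
    suff -> : Hs 0 = \sum_i E i by [].
    by apply: eq_bigr => i _; rewrite /y mul0r addr0 powR1 scale1r.
  have [s01|s01] := boolP (0 <= s <= 1); last by exists (U, h).
  have [|V [l [Vdec _]]] := @psd_eigdec _ _ (Hs s).
    by apply: psdmx_sum => // i; exact: powR_ge0.
  exists (V, l); split=> [/eqP|_]; first by rewrite (negPf s0).
  split=> //= j; rewrite -(eigdec_qf_diag j Vdec).
  (* [Hs s] dominates [rho^q] times the positive definite sum of the [E i]. *)
  apply: lt_le_trans (_ : rho `^ q * qf (\sum_i E i) (row j V) <= _).
    by rewrite mulr_gt0 ?powR_gt0 // (eigdec_qf_gt0 _ Hdec) // Vdec.1.
  rewrite -qfZ scaler_sumr !qf_sum; apply: ler_sum => i _.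
  rewrite ler_wpM2r ?psdmx_qf_ge0 // ge0_ler_powR ?nnegrE ?y_ge //.
  - by rewrite invr_ge0 ltW.
  - exact: ltW.
  - by rewrite ltW // y_gt0.
exists d; split; first exact: (dP 0).1.
by move=> s; exact: (dP s).2.
Qed.

(** Homogeneity of degree 1 removes the constant from the tangent inequality at 1: the value at [r]
    is at least the pairing of [r] with the gradient. *)
Theorem sum_powR_ge_tangent V l : eigdec (\sum_i r i `^ p^-1 *: E i) V l ->
  (forall k, 0 <= l 0 k) ->
  \sum_i r i * trpowmul U h (p - 1) (E i) <= \sum_k l 0 k `^ p.
Proof.
move=> Ldec l0; have [d [d0 dP]] := path_eigdec.
pose x s i := y s i `^ q.
pose g s i := trpowmul (d s).1 (d s).2 (p - 1) (E i).
(* As [p * q = 1], this is the partial derivative of the trace in the coordinate [y s i]. *)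
pose G s i := x s i * g s i / y s i.
pose psi s := \sum_j (d s).2 0 j `^ p.
pose t s s' i := x s' i / x s i.
have x0 s i : 0 <= s <= 1 -> 0 < x s i by move=> s01; rewrite powR_gt0 // y_gt0.
have g0 s i : 0 <= g s i by exact: trpowmul_ge0.
have t0 s s' i : 0 <= s <= 1 -> 0 <= s' <= 1 -> 0 < t s s' i.
  by move=> s01 s01'; rewrite divr_gt0 ?x0.
have tE s s' i : 0 <= s <= 1 -> 0 <= s' <= 1 -> t s s' i = (y s' i / y s i) `^ q.
  move=> s01 s01'; rewrite /t /x.
  have -> : y s' i `^ q = (y s' i / y s i) `^ q * y s i `^ q.
    by rewrite -powRM ?divfK ?gt_eqF ?divr_ge0 ?ltW ?y_gt0.
  by rewrite mulfK // gt_eqF // powR_gt0 // y_gt0.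
have tpE s s' i : 0 <= s <= 1 -> 0 <= s' <= 1 -> t s s' i `^ p = y s' i / y s i.
  move=> s01 s01'; rewrite tE // -powRrM /q mulVf ?gt_eqF // powRr1 //.
  by rewrite divr_ge0 // ltW // y_gt0.
have LE s s' : 0 <= s <= 1 -> 0 <= s' <= 1 ->
    Hs s' = \sum_i t s s' i *: (x s i *: E i).
  move=> s01 s01'; apply: eq_bigr => i _; rewrite scalerA divfK // gt_eqF //.
  exact: x0.
have xE_psd s i u : 0 <= s <= 1 -> 0 <= qf (x s i *: E i) u.
  by move=> s01; rewrite qfZ mulr_ge0 ?psdmx_qf_ge0 // ltW // x0.
(* Euler's identity for a function homogeneous of degree 1. *)
have psiE s : 0 <= s <= 1 -> psi s = \sum_i y s i * G s i.
  move=> s01; have [dec pos] := dP s s01.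
  rewrite /psi -(reweight_sum (E := fun i => x s i *: E i) dec pos (erefl _)).
  apply: eq_bigr => i _; rewrite trpowmulZ /G [in RHS]mulrC divfK // gt_eqF //.
  exact: y_gt0.
pose T := \sum_j (((1 + D) `^ q *: h) 0 j) `^ p.
have psi_le s : 0 <= s <= 1 -> psi s <= T.
  move=> s01; have [dec pos] := dP s s01.
  apply: (sum_powR_le _ dec _ (eigdecZ _ Hdec)).
  - by rewrite p_gt0.
  - by move=> j; exact: ltW.
  move=> u; rewrite scaler_sumr !qf_sum; apply: ler_sum => i _.
  rewrite ler_wpM2r ?psdmx_qf_ge0 // ge0_ler_powR ?nnegrE ?y_le //.
  - by rewrite invr_ge0 ltW.
  - by rewrite ltW // y_gt0.
  - by rewrite addr_ge0.
have T0 : 0 <= T by rewrite sumr_ge0 // => j _; exact: powR_ge0.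
have e_sum s : 0 <= s <= 1 -> \sum_i x s i * g s i = psi s.
  move=> s01; rewrite psiE //; apply: eq_bigr => i _.
  by rewrite /G mulrCA mulfV ?mulr1 // gt_eqF // y_gt0.
(* [B] is a Lipschitz constant for the ratios [t s s' i]: the factor [4 * q] comes from
   [powR_near1], and [D / rho] bounds the relative variation of [y]. The 1 in [dl] keeps it defined
   when [B = 0], and [B * dl <= 1] is what [powR_near1] requires. *)
pose B := 4 * q * (D / rho).
pose dl := (B + 1)^-1.
have q0 : 0 <= q by rewrite invr_ge0 ltW.
have B0 : 0 <= B.
  by apply: mulr_ge0; [rewrite mulr_ge0|rewrite divr_ge0 ?D_ge0 ?(ltW rho_gt0)].
have dl0 : 0 < dl by rewrite invr_gt0; have := rinv0; lra.
have t_near s s' i : 0 <= s <= 1 -> 0 <= s' <= 1 -> `|s' - s| <= dl ->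
    `|t s s' i - 1| <= B * `|s' - s| /\ (t s s' i)^-1 <= 2.
  move=> s01 s01' ss'.
  have u_le : `|y s' i / y s i - 1| <= D / rho * `|s' - s|.
    have -> : y s' i / y s i - 1 = (r i - 1) / y s i * (s' - s).
      by rewrite /y; field; rewrite -/(y s i) gt_eqF // y_gt0.
    rewrite normrM ler_wpM2r // normrM ler_pM // normfV lef_pV2 ?posrE //.
      by rewrite gtr0_norm ?y_ge // y_gt0.
    by rewrite normr_gt0 gt_eqF // y_gt0.
  have B_le : B * `|s' - s| <= 1.
    apply: le_trans (_ : B * dl <= _); first by rewrite ler_wpM2l.
    by rewrite /dl ler_pdivrMr; lra.
  have q4 : 0 <= 4 * q by lra.
  have [|tn t2 _] := @powR_near1 _ q (y s' i / y s i) q_ge1.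
    apply: le_trans B_le; rewrite mulrC /B -[leRHS]mulrA.
    by rewrite ler_wpM2l.
  rewrite tE //; split.
    by apply: le_trans tn _; rewrite /B -[leRHS]mulrA ler_wpM2l.
  rewrite -[leRHS]invrK lef_pV2 ?posrE ?invr_gt0 //; apply: powR_gt0.
  by rewrite divr_gt0 ?y_gt0.
clearbody dl B.
(* The defect of the tangent inequality between two points of the path. *)
pose Rem s s' := psi s' - \sum_i y s' i * G s i.
have RemE s s' : 0 <= s <= 1 -> 0 <= s' <= 1 ->
    Rem s s' = psi s' - \sum_i t s s' i `^ p * (x s i * g s i).
  move=> s01 s01'; congr (_ - _); apply: eq_bigr => i _.
  by rewrite tpE // /G mulrCA [in RHS]mulrC -!mulrA.
pose K2 := 2 * B ^+ 2 * T.
pose K3 := 2 * B ^+ 3 * T.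
have K20 : 0 <= K2 by rewrite mulr_ge0 // mulr_ge0 // exprn_ge0.
have K30 : 0 <= K3 by rewrite mulr_ge0 // mulr_ge0 // exprn_ge0.
have pow_near s s' (m : nat) : 0 <= s <= 1 -> 0 <= s' <= 1 -> `|s' - s| <= dl ->
    \sum_i `|t s s' i - 1| ^+ m / t s s' i * (x s i * g s i)
      <= 2 * B ^+ m * T * `|s' - s| ^+ m.
  move=> s01 s01' ss'.
  apply: le_trans (_ : \sum_i 2 * (B * `|s' - s|) ^+ m * (x s i * g s i) <= _).
    apply: ler_sum => i _; have [t1 t2] := t_near s s' i s01 s01' ss'.
    rewrite ler_wpM2r ?mulr_ge0 ?g0 //; first by rewrite ltW // x0.
    rewrite mulrC; apply: ler_pM => //.
    - by rewrite invr_ge0 ltW // t0.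
    - exact: exprn_ge0.
    - by apply: lerXn2r; rewrite ?nnegrE ?mulr_ge0.
  rewrite -mulr_sumr e_sum // exprMn -!mulrA [T * _]mulrC !mulrA.
  by rewrite ler_wpM2l ?psi_le // mulr_ge0 ?exprn_ge0 // mulr_ge0 ?exprn_ge0.
have scaled s (f : I -> R) :
    \sum_i f i * trpowmul (d s).1 (d s).2 (p - 1) (x s i *: E i) =
    \sum_i f i * (x s i * g s i).
  by apply: eq_bigr => i _; rewrite trpowmulZ.
(* A quadratic bound for one step: the tangent bound of [t^p] is rewritten with
   [t - 1 = (1 - t^-1) + (t - 1)^2 / t], whose first part cancels against the spectral lower
   bound. *)
have Rem_ge s s' : 0 <= s <= 1 -> 0 <= s' <= 1 -> `|s' - s| <= dl ->
    - (K2 * `|s' - s| ^+ 2) <= Rem s s'.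
  move=> s01 s01' ss'; have [dec pos] := dP s s01; have [dec' pos'] := dP s' s01'.
  have lb := @spectral_sum_lower_bound _ _ _ (fun i => x s i *: E i) (t s s') _ _ _ _ _ _
    (fun i u => xE_psd s i u s01) (fun i => t0 s s' i s01 s01') dec dec' pos pos'
    (erefl _) (LE s s' s01 s01') p p (@powR R ^~ p) (ltW p_gt0)
    (fun y z => @powR_lower_bound R p y z (ltW p_gt0)).
  rewrite RemE //; have pn := pow_near s s' 2%N s01 s01' ss'; rewrite -/K2 in pn.
  apply: le_trans (_ : - (\sum_i `|t s s' i - 1| ^+ 2 / t s s' i * (x s i * g s i)) <= _).
    by rewrite lerN2.
  have tl : \sum_i t s s' i `^ p * (x s i * g s i) <=
      \sum_i (x s i * g s i) + p * \sum_i (1 - (t s s' i)^-1) * (x s i * g s i)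
      + \sum_i `|t s s' i - 1| ^+ 2 / t s s' i * (x s i * g s i).
    rewrite mulr_sumr -!big_split /=; apply: ler_sum => i _.
    have ti := t0 s s' i s01 s01'; set z := t s s' i in ti *.
    have xg : 0 <= x s i * g s i by rewrite mulr_ge0 // ltW // x0.
    rewrite [leRHS](_ : _ = (1 + p * (1 - z^-1) + `|z - 1| ^+ 2 / z) *
      (x s i * g s i)); last by ring.
    rewrite ler_wpM2r //.
    apply: le_trans (powR_le_tangent1 p01 (ltW ti)) _.
    have z0 : 0 <= (z - 1) ^+ 2 / z by rewrite divr_ge0 ?sqr_ge0 // ltW.
    have := ler_wpM2r z0 p_le1; rewrite real_normK ?num_real //.
    have -> : (z - 1) ^+ 2 / z = z - 2 + z^-1 by field; rewrite gt_eqF.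
    lra.
  move: lb tl; rewrite -/(psi s) -/(psi s') e_sum //.
  rewrite scaled; lra.
(* The sum of both directions loses only a cubic term: exchanging the endpoints transposes the
   overlap weights, so the defects pair up as in [stepdefect_sym_ge0]. *)
have Rem_sym s s' : 0 <= s <= 1 -> 0 <= s' <= 1 -> `|s' - s| <= dl ->
    - (2 * K3 * `|s' - s| ^+ 3) <= Rem s s' + Rem s' s.
  move=> s01 s01' ss'; have [dec pos] := dP s s01; have [dec' pos'] := dP s' s01'.
  have lb := @step_lower_bound _ _ _ (fun i => x s i *: E i) (t s s') _ _ _ _ _ _
    (fun i u => xE_psd s i u s01) (fun i => t0 s s' i s01 s01') dec dec' pos pos'
    (erefl _) (LE s s' s01 s01') p p01.
  have lb' := @step_lower_bound _ _ _ (fun i => x s' i *: E i) (t s' s) _ _ _ _ _ _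
    (fun i u => xE_psd s' i u s01') (fun i => t0 s' s i s01' s01) dec' dec pos' pos
    (erefl _) (LE s' s s01' s01) p p01.
  have pn := pow_near s s' 3%N s01 s01' ss'; rewrite -/K3 in pn.
  have ss'' : `|s - s'| <= dl by rewrite distrC.
  have := pow_near s' s 3%N s01' s01 ss''; rewrite (distrC s s') -/K3 => pn'.
  have kp : 0 <= p * (1 - p) / 2 <= 1.
    have q0' : 0 <= 1 - p by rewrite subr_ge0.
    rewrite divr_ge0 ?(mulr_ge0 (ltW p_gt0) q0') //= ler_pdivrMr // mul1r.
    apply: le_trans (ler_wpM2r q0' p_le1) _; rewrite mul1r.
    by apply: le_trans (_ : 1 <= _); rewrite ?gerBl ?ler1n // ltW.
  have S_ge0 (v v' : R) : 0 <= v <= 1 -> 0 <= v' <= 1 ->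
      0 <= \sum_i `|t v v' i - 1| ^+ 3 / t v v' i * (x v i * g v i).
    move=> v01 v01'; rewrite sumr_ge0 // => i _; rewrite mulr_ge0 //.
      by rewrite divr_ge0 ?exprn_ge0 // ltW // t0.
    by rewrite mulr_ge0 // ltW // x0.
  have S1 := S_ge0 s s' s01 s01'; have S2 := S_ge0 s' s s01' s01.
  move: lb lb'; rewrite -/(psi s) -/(psi s').
  rewrite !scaled -!RemE //.
  set c1 := \sum_j _; set c2 := \sum_j _.
  have c12 : 0 <= c1 + c2.
    rewrite /c2 exchange_big /c1 -big_split sumr_ge0 //= => j _.
    rewrite -big_split sumr_ge0 //= => k _.
    rewrite (overlapC (d s').1) -mulrDr mulr_ge0 ?sqr_ge0 //.
    exact: stepdefect_sym_ge0.
  case/andP: kp => k0 k1; have := ler_wpM2r S1 k1; have := ler_wpM2r S2 k1.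
  lra.
(* The derivative of [psi] along the path, as given by the gradient [G]. *)
pose a s := \sum_i (r i - 1) * G s i.
have Rem_a s s' : 0 <= s <= 1 -> 0 <= s' <= 1 ->
    Rem s s' + Rem s' s = (s' - s) * (a s' - a s).
  move=> s01 s01'; rewrite /Rem (psiE s) // (psiE s') // /a.
  rewrite -!sumrB -big_split mulr_sumr /=.
  by apply: eq_bigr => i _; rewrite /y; ring.
have in01 (s s' : R) : 0 <= s -> s <= s' -> s' <= 1 -> 0 <= s <= 1 /\ 0 <= s' <= 1.
  by move=> s0 ss' s1; rewrite s0 s1 (le_trans s0 ss') (le_trans ss' s1).
(* Dividing the cubic loss by [s' - s] leaves the quadratic loss that [le_of_quadratic_loss]
   allows. *)
have a_mono b : 0 <= b <= 1 -> a 0 <= a b.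
  move=> b01; apply: (@le_of_quadratic_loss R a (2 * K3) dl b) => //.
    by rewrite mulr_ge0.
  move=> s s' s0 ss' s1 dss; have [s01 s01'] := in01 s s' s0 ss' s1.
  have [->|ne] := eqVneq s s'; first by rewrite subrr expr0n mulr0 subr0.
  have ds : 0 < s' - s by rewrite subr_gt0 lt_neqAle ne.
  have nd : `|s' - s| = s' - s by rewrite gtr0_norm.
  have := Rem_sym s s' s01 s01'; rewrite nd Rem_a // => /(_ dss) le3.
  rewrite -subr_ge0 -(pmulr_rge0 _ ds); lra.
(* The defect of the tangent inequality at the starting point. *)
pose rem0 s := psi s - \sum_i y s i * G 0 i.
have z01 : 0 <= (0 : R) <= 1 by rewrite lexx ler01.
have o01 : 0 <= (1 : R) <= 1 by rewrite lexx ler01.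
(* Each increment of [rem0] is [Rem s s'], of at most quadratic loss, plus [(s' - s) * (a s - a 0)],
   which is nonnegative by [a_mono]. *)
have : rem0 0 <= rem0 1.
  apply: (@le_of_quadratic_loss R rem0 K2 dl 1) => //.
  move=> s s' s0 ss' s1 dss; have [s01 s01'] := in01 s s' s0 ss' s1.
  have ds : 0 <= s' - s by rewrite subr_ge0.
  have nd : `|s' - s| = s' - s by rewrite ger0_norm.
  have := Rem_ge s s' s01 s01'; rewrite nd => /(_ dss) le2.
  have := mulr_ge0 ds (_ : 0 <= a s - a 0); rewrite subr_ge0 => /(_ (a_mono s s01)).
  suff -> : rem0 s' = rem0 s + Rem s s' + (s' - s) * (a s - a 0) by lra.
  have -> : (s' - s) * (a s - a 0) = \sum_i y s' i * G s i - \sum_i y s i * G s i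
      - \sum_i y s' i * G 0 i + \sum_i y s i * G 0 i.
    rewrite /a -sumrB mulr_sumr -!sumrB -big_split /=.
    by apply: eq_bigr => i _; rewrite /y; ring.
  by rewrite /rem0 /Rem -(psiE s) //; ring.
rewrite {1}/rem0 -psiE // subrr /rem0 subr_ge0.
have y1 i : y 1 i = r i by rewrite /y mul1r addrC subrK.
have y0 i : y 0 i = 1 by rewrite /y mul0r addr0.
move=> le1; apply: le_trans (_ : psi 1 <= _).
  apply: le_trans le1; rewrite le_eqVlt; apply/orP; left; apply/eqP.
  apply: eq_bigr => i _.
  by rewrite y1 /G /x /g y0 powR1 mul1r divr1 d0.
(* [d 1] and [(V, l)] decompose the same matrix; [sum_powR_le] passes from one to the other. *)
have [dec1 pos1] := dP 1 o01.
have Hs1 : Hs 1 = \sum_i r i `^ p^-1 *: E i.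
  by apply: eq_bigr => i _; rewrite y1.
rewrite -Hs1 in Ldec; apply: (sum_powR_le _ dec1 _ Ldec) => // [|j].
  by rewrite p_gt0.
exact: ltW.
Qed.

End Path.

(** * Rank, determinant and trace from the spectrum *)

(** Adding ones at the zero entries makes the matrix invertible, and this correction has rank at
    most the number of zeros. *)
Lemma card_le_rank_diag_mx (F : fieldType) n (a : 'rV[F]_n) :
  (#|[pred k | a 0%R k != 0%R]| <= \rank (diag_mx a))%N.
Proof.
pose b : 'rV[F]_n := \row_k (a 0 k == 0)%:R.
have ab : \rank (diag_mx a + diag_mx b)%R = n.
  apply: mxrank_unit; rewrite unitmxE -linearD det_diag unitfE.
  apply/prodf_neq0 => k _; rewrite !mxE.
  have [->|a0] := eqVneq (a 0 k) 0; first by rewrite add0r oner_eq0.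
  by rewrite addr0.
have rb : (\rank (diag_mx b) <= #|[pred k | a 0%R k == 0%R]|)%N.
  rewrite diag_mx_sum_delta -sum1_card [leqRHS]big_mkcond /=.
  apply: (big_ind2 (fun (A : 'M_n) r => (\rank A <= r)%N)) => [|A1 r1 A2 r2 le1 le2|k _].
  - by rewrite mxrank0.
  - exact: leq_trans (mxrank_add _ _) (leq_add le1 le2).
  rewrite mxE inE; case: (a 0 k == 0); last by rewrite scale0r mxrank0.
  by rewrite scale1r mxrank_delta.
have := cardC [pred k | a 0 k == 0]; rewrite card_ord -[RHS]ab => cn.
rewrite -(leq_add2l #|[pred k | a 0%R k == 0%R]|).
rewrite [X in (X <= _)%N]cn (leq_trans (mxrank_add _ _)) // addnC.
by rewrite leq_add2r.
Qed.

Section Spectra.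
Variables (R : realType) (n : nat).
Implicit Types (H L U V : 'M[R]_n) (h l : 'rV[R]_n).

Lemma eigdec_det H U h : eigdec H U h -> \det H = \prod_j h 0 j.
Proof.
move=> [UU ->]; rewrite !det_mulmx det_diag mulrAC -det_mulmx.
by rewrite (mulmx1C UU) det1 mul1r.
Qed.

Lemma eigdec_char_poly H U h : eigdec H U h ->
  char_poly H = \prod_(x <- [seq h 0 j | j <- index_enum 'I_n]) ('X - x%:P).
Proof.
move=> [UU ->]; rewrite big_map.
pose UC := map_mx (@polyC R) U.
have UCU : UC^T *m UC = 1%:M.
  by rewrite /UC map_trmx -map_mxM (mulmx1C UU) map_mx1.
rewrite /char_poly.
have -> : char_poly_mx (U^T *m diag_mx h *m U) = UC^T *m char_poly_mx (diag_mx h) *m UC.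
  rewrite /char_poly_mx mulmxBr mulmxBl !map_mxM -map_trmx; congr (_ - _).
  by rewrite scalar_mxC -mulmxA UCU mulmx1.
rewrite !det_mulmx mulrAC -det_mulmx UCU det1 mul1r.
rewrite /char_poly_mx map_diag_mx -diag_const_mx -linearB det_diag.
by apply: eq_bigr => j _; rewrite !mxE.
Qed.

Lemma eigdec_trace_pow p H U h : p != 0 -> eigdec H U h ->
  trace_pow p H = \sum_j h 0 j `^ p.
Proof.
move=> p0 dec; rewrite /trace_pow (negPf p0).
rewrite (perm_big _ (eigenvalsP (eigdec_char_poly dec))) /=.
by rewrite big_map.
Qed.

Lemma eigdec_gt0 H U h : eigdec H U h -> (forall j, 0 <= h 0 j) ->
  \det H != 0 -> forall j, 0 < h 0 j.
Proof.
move=> dec h0; rewrite (eigdec_det dec) => /prodf_neq0 hn j.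
by rewrite lt0r hn // h0.
Qed.

Lemma card_le_rank H U h : eigdec H U h ->
  (#|[pred k | h 0%R k != 0%R]| <= \rank H)%N.
Proof.
move=> [UU ->].
have Uu : U \in unitmx by have := mulmx1_unit UU; case.
rewrite mxrankMfree ?row_free_unit // eqmxMfull ?row_full_unit ?unitmx_tr //.
exact: card_le_rank_diag_mx.
Qed.

(** In the eigenbasis [v_k] of [A] the trace is the sum of [a_k b_k], where [b_k] is the value of
    [H^-1] at [v_k]. Testing [A <= H] on [v_k H^-1] gives [a_k b_k^2 <= b_k], so each nonzero [a_k]
    contributes at most 1. *)
Lemma trace_inv_le_rank H U h A : psdmx A -> eigdec H U h ->
  (forall j, 0 < h 0 j) -> (forall u, qf A u <= qf H u) ->
  trpowmul U h (- 1) A <= (\rank A)%:R.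
Proof.
move=> Apsd Hdec h0 AH; have [V [a [Adec a0]]] := psd_eigdec Apsd.
pose c j k := (U *m V^T) j k; pose b k := \sum_j c j k ^+ 2 / h 0 j.
have -> : trpowmul U h (- 1) A = \sum_k a 0 k * b k.
  rewrite /trpowmul; under eq_bigr => j _ do
    rewrite (eigdec_qf_row _ _ Adec) mulr_sumr.
  rewrite exchange_big /=; apply: eq_bigr => k _; rewrite mulr_sumr.
  by apply: eq_bigr => j _; rewrite powR_inv1 ?ltW // mulrCA [_^-1 * _]mulrC.
apply: le_trans (_ : (\sum_(k | a 0 k != 0) 1)%:R <= _); last first.
  by rewrite ler_nat sum1_card; exact: card_le_rank Adec.
rewrite natr_sum [leRHS]big_mkcond /=; apply: ler_sum => k _.
case: eqVneq => [->|ak] /=; first by rewrite mul0r.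
pose x := (\row_j (c j k / h 0 j)) *m U.
have xU : x *m U^T = \row_j (c j k / h 0 j) by rewrite /x -mulmxA Hdec.1 mulmx1.
have Hx : qf H x = b k.
  rewrite (eigdec_qf _ Hdec) xU; apply: eq_bigr => j _; rewrite mxE.
  by field; rewrite gt_eqF.
have xV : (x *m V^T) 0 k = b k.
  rewrite -mulmxA mxE; apply: eq_bigr => j _; rewrite mxE -/(c j k).
  by rewrite mulrAC expr2.
have Ax : a 0 k * b k ^+ 2 <= qf A x.
  rewrite (eigdec_qf _ Adec) (bigD1 k) //= xV lerDl sumr_ge0 // => i _.
  by rewrite mulr_ge0 ?sqr_ge0.
have b0 : 0 <= b k.
  by rewrite sumr_ge0 // => j _; rewrite divr_ge0 ?sqr_ge0 // ltW.
have := le_trans Ax (AH x); rewrite Hx.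
move: b0; rewrite le0r => /predU1P[->|b0]; first by rewrite mulr0.
by rewrite expr2 mulrA ger_pMl.
Qed.

Lemma psd_qf_eq0 A (x : 'rV[R]_n) : psdmx A -> qf A x = 0 -> x *m A = 0.
Proof.
move=> Apsd; have [V [a [Adec a0]]] := psd_eigdec Apsd.
rewrite (eigdec_qf _ Adec) => /eqP; rewrite psumr_eq0 => [/allP ax|k _]; last first.
  by rewrite mulr_ge0 ?sqr_ge0.
case: Adec => _ ->; rewrite !mulmxA.
suff -> : x *m V^T *m diag_mx a = 0 by rewrite mul0mx.
apply/rowP => k; rewrite mul_mx_diag mxE [RHS]mxE.
have := ax k (mem_index_enum _); rewrite /= mulf_eq0 sqrf_eq0.
by case/orP => /eqP ->; rewrite ?mulr0 ?mul0r.
Qed.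

Lemma psd_rank_le A L : psdmx A -> (forall u, u *m L = 0 -> qf A u = 0) ->
  (\rank A <= \rank L)%N.
Proof.
move=> Apsd AL; have : (kermx L <= kermx A)%MS.
  apply/row_subP => i; apply/sub_kermxP/psd_qf_eq0 => //; apply: AL.
  by rewrite -row_mul mulmx_ker row0.
move=> /mxrankS; rewrite !mxrank_ker leq_sub2lE // rank_leq_row //.
Qed.

End Spectra.

(** * Optimality conditions *)

Section Optimality.
Variables (R : realType) (m s : nat) (M : 'I_s -> 'M[R]_m) (N : nat) (p : R).
Variable w : 'I_s -> R.
Hypothesis m_gt0 : (0 < m)%N.
Hypothesis M_psd : forall i, psdmx (M i).
Hypothesis M_rank : \rank (\sum_(k < s) M k)%R = m.
Hypothesis N_ge1 : (1 <= N)%N.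
Hypotheses (p_ge0 : 0 <= p) (p_le1 : p <= 1).
Hypothesis w_opt : optimal M N p w.
Variables (U : 'M[R]_m) (h : 'rV[R]_m).
Hypothesis Hdec : eigdec (infomx M w) U h.
Hypothesis h_ge0 : forall j, 0 <= h 0 j.

Let w_ge0 i : 0 <= w i. Proof. by case: w_opt => -[]. Qed.
Let N_gt0 : 0 < N%:R :> R. Proof. by rewrite ltr0n. Qed.

Lemma infomx_psd (v : 'I_s -> R) : (forall i, 0 <= v i) -> psdmx (infomx M v).
Proof. exact: psdmx_sum. Qed.

Lemma optimal_sum_powR v V l : 0 < p -> feasible N v -> eigdec (infomx M v) V l ->
  (forall k, 0 <= l 0 k) -> \sum_k l 0 k `^ p <= \sum_j h 0 j `^ p.
Proof.
move=> p0 vN Ldec l0; have pn : p != 0 by rewrite gt_eqF.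
have := w_opt.2 v vN; rewrite /Phi (negPf pn).
rewrite (eigdec_trace_pow pn Ldec) (eigdec_trace_pow pn Hdec) => le.
have m0 : 0 < m%:R^-1 :> R by rewrite invr_gt0 ltr0n.
rewrite leNgt; apply/negP => lt; move: le; rewrite leNgt => /negP; apply.
have pos (f : 'I_m -> R) : m%:R^-1 * \sum_j f j `^ p \in Num.nneg.
  by rewrite nnegrE mulr_ge0 ?invr_ge0 // sumr_ge0 // => j _; exact: powR_ge0.
by apply: gt0_ltr_powR; rewrite ?invr_gt0 ?pos // ltr_pM2l.
Qed.

Lemma optimal_prod v V l : p = 0 -> feasible N v -> eigdec (infomx M v) V l ->
  (forall k, 0 <= l 0 k) -> \prod_k l 0 k <= \prod_j h 0 j.
Proof.
move=> p0 vN Ldec l0; have := w_opt.2 v vN; rewrite /Phi p0 eqxx.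
rewrite (eigdec_det Ldec) (eigdec_det Hdec) => le.
have m0 : 0 < m%:R^-1 :> R by rewrite invr_gt0 ltr0n.
rewrite leNgt; apply/negP => lt; move: le; rewrite leNgt => /negP; apply.
by rewrite gt0_ltr_powR // ?nnegrE ?prodr_ge0.
Qed.

(** A competitor whose matrix is a positive multiple of the sum of the [M i], hence invertible. *)
Let unif (i : 'I_s) : R := N%:R / s%:R.

Let s_gt0 : 0 < s%:R :> R.
Proof.
rewrite ltr0n lt0n; apply/eqP => s0; move: m_gt0; rewrite -M_rank.
by rewrite big1 ?mxrank0 // => i _; move: (ltn_ord i); rewrite {2}s0.
Qed.

Let unif_feasible : feasible N unif.
Proof.
split; first by move=> i; rewrite divr_ge0.
rewrite sumr_const card_ord -[_ *+ s]mulr_natr divfK ?lexx // gt_eqF //.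
Qed.

Let unif_eigdec : exists Z (z : 'rV[R]_m),
  eigdec (infomx M unif) Z z /\ forall k, 0 < z 0 k.
Proof.
have [|Z [z [dec z0]]] := @psd_eigdec _ _ (infomx M unif).
  by apply: infomx_psd; case: unif_feasible.
exists Z, z; split=> //; apply: (eigdec_gt0 dec z0).
rewrite -unitfE -unitmxE -row_full_unit /row_full /infomx -scaler_sumr.
by rewrite mxrank_scale_nz ?M_rank // mulf_neq0 ?invr_eq0 ?gt_eqF.
Qed.

Lemma optimal_sum_powR_gt0 : 0 < p -> 0 < \sum_j h 0 j `^ p.
Proof.
move=> p0; have [Z [z [dec z0]]] := unif_eigdec.
apply: lt_le_trans (optimal_sum_powR p0 unif_feasible dec _); last first.
  by move=> k; exact: ltW.
rewrite (bigD1 (Ordinal m_gt0)) //= ltr_wpDr ?powR_gt0 // sumr_ge0 // => j _.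
exact: powR_ge0.
Qed.

(** The power [p < 1] has infinite slope at 0: mixing in a fraction [e] of [unif] would gain order
    [e^p] on a zero eigenvalue and lose at most order [e] elsewhere. For [p = 0] the determinant
    must be positive. *)
Lemma optimal_pd : p < 1 -> forall j, 0 < h 0 j.
Proof.
move=> p1; have [Z [z [dec z0]]] := unif_eigdec.
have [p0|pn] := eqVneq p 0.
  apply: (eigdec_gt0 Hdec h_ge0); rewrite (eigdec_det Hdec) gt_eqF //.
  apply: lt_le_trans (optimal_prod p0 unif_feasible dec _).
    by rewrite prodr_gt0.
  by move=> k; exact: ltW.
have p0 : 0 < p by rewrite lt0r pn.
move=> j0; rewrite lt0r h_ge0 andbT; apply/eqP => hj0.
pose S := \sum_j h 0 j `^ p.
have S0 : 0 < S by exact: optimal_sum_powR_gt0.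
pose c := (1 + \sum_k (z 0 k)^-1)^-1.
have zs : 0 <= \sum_k (z 0 k)^-1 by rewrite sumr_ge0 // => k _; rewrite invr_ge0 ltW.
have c0 : 0 < c by rewrite invr_gt0; lra.
have cz k : c <= z 0 k.
  rewrite -[leRHS]invrK lef_pV2 ?posrE ?invr_gt0 //; last by lra.
  rewrite (bigD1 k) //= addrCA lerDl addr_ge0 // sumr_ge0 // => i _.
  by rewrite invr_ge0 ltW.
(* [e] is defined by [e^(1 - p) = dl], so that the loss [e * S = e^p * (dl * S)] stays below the
   gain [e^p * c^p]. *)
pose dl := c `^ p / (S + c `^ p + 1).
have cp : 0 < c `^ p by exact: powR_gt0.
have dl0 : 0 < dl by rewrite divr_gt0 //; lra.
have dl1 : dl < 1 by rewrite ltr_pdivrMr; lra.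
have dlS : dl * S < c `^ p by rewrite mulrAC ltr_pdivrMr ?ltr_pM2l //; lra.
pose e := dl `^ (1 - p)^-1.
have e0 : 0 < e by exact: powR_gt0.
have ep : e `^ (1 - p) = dl.
  by rewrite -powRrM mulVf ?powRr1 1?ltW // gt_eqF // subr_gt0.
have e1 : e < 1.
  have -> : 1 = 1 `^ (1 - p)^-1 :> R by rewrite powR1.
  by rewrite gt0_ltr_powR ?nnegrE ?invr_gt0 ?subr_gt0 ?(ltW dl0).
pose v i := (1 - e) * w i + e * unif i.
have e1' : 0 <= 1 - e by lra.
have vN : feasible N v.
  split=> [i|]; first by rewrite addr_ge0 // mulr_ge0 // ?(ltW e0) // unif_feasible.1.
  rewrite big_split -2!mulr_sumr /=.
  have := ler_wpM2l e1' w_opt.1.2; have := ler_wpM2l (ltW e0) unif_feasible.2.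
  lra.
have [|V [l [Ldec l0]]] := @psd_eigdec _ _ (infomx M v).
  by apply: infomx_psd; case: vN.
have opt := optimal_sum_powR p0 vN Ldec l0.
(* The eigenvalues of [(1 - e) H + e c I], which the mixture dominates because [c] bounds the
   spectrum of [unif] from below. *)
pose h' : 'rV[R]_m := \row_j ((1 - e) * h 0 j + e * c).
have H'dec : eigdec (U^T *m diag_mx h' *m U) U h' by split=> //; exact: Hdec.1.
have h'E j : h' 0 j = (1 - e) * h 0 j + e * c by rewrite mxE.
have h'0 j : 0 <= h' 0 j by rewrite h'E addr_ge0 // mulr_ge0 // ltW.
have : \sum_j h' 0 j `^ p <= \sum_k l 0 k `^ p.
  apply: (sum_powR_le _ H'dec h'0 Ldec) => [|u]; first by rewrite p0.
  have -> : infomx M v = (1 - e) *: infomx M w + e *: infomx M unif.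
    rewrite /infomx !scaler_sumr -big_split; apply: eq_bigr => i _.
    by rewrite /= !scalerA -scalerDl.
  rewrite qfD !qfZ (eigdec_qf _ H'dec) (eigdec_qf _ Hdec) (eigdec_qf _ dec).
  under eq_bigr => j _ do rewrite h'E mulrDl -!mulrA.
  rewrite big_split -!mulr_sumr /= lerD2l ler_wpM2l ?(ltW e0) //.
  rewrite (orthogonal_row_norm u Hdec.1) -(orthogonal_row_norm u dec.1) mulr_sumr.
  by apply: ler_sum => k _; rewrite ler_wpM2r ?sqr_ge0.
move=> /le_trans /(_ opt); rewrite -/S leNgt => /negP; apply.
rewrite (bigD1 j0) //= h'E hj0 mulr0 add0r powRM ?(ltW e0) ?(ltW c0) //.
have le1 : (1 - e) * S <= \sum_(i | i != j0) h' 0 i `^ p.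
  rewrite mulr_sumr (bigD1 j0) //= hj0 powR0 // mulr0 add0r.
  apply: ler_sum => j _; apply: le_trans (_ : ((1 - e) * h 0 j) `^ p <= _).
    rewrite powRM // ler_wpM2r ?powR_ge0 //.
    by rewrite ger1_powR //; apply/andP; split; lra.
  rewrite ge0_ler_powR ?nnegrE ?mulr_ge0 // h'E lerDl mulr_ge0 //; exact: ltW.
have le2 : e * S < e `^ p * c `^ p.
  have -> : e * S = e `^ p * (dl * S).
    rewrite -ep mulrA -powRD ?(gt_eqF e0) ?implybT //.
    by rewrite addrCA subrr addr0 powRr1 // ltW.
  by rewrite ltr_pM2l // powR_gt0.
by rewrite -/S; lra.
Qed.

End Optimality.

Lemma le_of_le_shrink (R : realType) (x y : R) : 0 <= y ->
  (forall e, 0 < e < 1 -> x * (1 - e) <= y) -> x <= y.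
Proof.
move=> y0 xy; rewrite leNgt; apply/negP => yx; have x0 : 0 < x by lra.
have := xy ((x - y) / (2 * x)).
have -> : x * (1 - (x - y) / (2 * x)) = x - (x - y) / 2 by field; rewrite gt_eqF.
suff -> : 0 < (x - y) / (2 * x) < 1 by move=> /(_ isT); lra.
by rewrite divr_gt0 ?mulr_gt0 ?subr_gt0 // ltr_pdivrMr ?mulr_gt0 //=; lra.
Qed.

Lemma ln_prod (R : realType) (I : finType) (f : I -> R) : (forall i, 0 < f i) ->
  ln (\prod_i f i) = \sum_i ln (f i).
Proof.
move=> f0; suff [] : 0 < \prod_i f i /\ ln (\prod_i f i) = \sum_i ln (f i) by [].
elim/big_rec2: _ => [|i x y _ [y0 yx]]; first by rewrite ln1 ltr01.
by rewrite mulr_gt0 // lnM ?posrE // yx.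
Qed.

(** * First-order optimality, by shrinking a single weight *)

Section Kiefer.
Variables (R : realType) (m s : nat) (M : 'I_s -> 'M[R]_m) (N : nat) (p : R).
Variable w : 'I_s -> R.
Hypothesis m_gt0 : (0 < m)%N.
Hypothesis M_psd : forall i, psdmx (M i).
Hypothesis M_rank : \rank (\sum_(k < s) M k)%R = m.
Hypothesis N_ge1 : (1 <= N)%N.
Hypotheses (p_ge0 : 0 <= p) (p_le1 : p <= 1).
Hypothesis w_opt : optimal M N p w.
Variables (U : 'M[R]_m) (h : 'rV[R]_m).
Hypothesis Hdec : eigdec (infomx M w) U h.
Hypothesis h_ge0 : forall j, 0 <= h 0 j.

Let E i := w i *: M i.
Let w_ge0 i : 0 <= w i. Proof. by case: w_opt => -[]. Qed.
Let N_gt0 : 0 < N%:R :> R. Proof. by rewrite ltr0n. Qed.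

Let w_le i : w i / N%:R <= 1.
Proof.
rewrite ler_pdivrMr // mul1r; apply: le_trans w_opt.1.2.
by rewrite (bigD1 i) //= lerDl sumr_ge0.
Qed.

Let E_psd i : psdmx (E i). Proof. exact: psdmxZ. Qed.

Section Shrink.
Variables (i0 : 'I_s) (e : R).
Hypothesis e01 : 0 < e < 1.

Let a := w i0 / N%:R.
Let t i : R := if i == i0 then 1 - e else 1.
(** Weight [i0] is reduced by the factor [1 - e] and the budget thus freed is spread proportionally;
    [a] is the share of [i0] in the budget. *)
Let v i := (1 - e * a)^-1 * (t i * w i).

Let a_ge0 : 0 <= a. Proof. by rewrite divr_ge0. Qed.
Let a_le1 : a <= 1. Proof. exact: w_le. Qed.
Let ea_gt0 : 0 < 1 - e * a.
Proof.
case/andP: e01 => e0 e1; have := ler_wpM2l (ltW e0) a_le1.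
by move: (a) => b; lra.
Qed.
Let t_gt0 i : 0 < t i.
Proof. by rewrite /t; case: ifP => // _; case/andP: e01 => ? ?; lra. Qed.

Lemma shrink_feasible : feasible N v.
Proof.
split=> [i|].
  by rewrite mulr_ge0 ?invr_ge0 ?(ltW ea_gt0) // mulr_ge0 // ltW.
rewrite -mulr_sumr ler_pdivrMl // (bigD1 i0) //= {1}/t eqxx.
have -> : \sum_(i < s | i != i0) t i * w i = \sum_(i < s | i != i0) w i.
  by apply: eq_bigr => i /negPf ii0; rewrite /t ii0 mul1r.
have := w_opt.1.2; rewrite (bigD1 i0) //=.
have -> : (1 - e * a) * N%:R = N%:R - e * w i0.
  by rewrite /a; field; rewrite gt_eqF.
lra.
Qed.

Lemma shrink_infomx : infomx M v = (1 - e * a)^-1 *: \sum_i t i *: E i.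
Proof.
by rewrite /infomx scaler_sumr; apply: eq_bigr => i _; rewrite /E !scalerA /v !mulrA.
Qed.

Lemma shrink_sum (f g : 'I_s -> R) (c : R) : (forall i, i != i0 -> f i = 0) ->
  f i0 = c -> \sum_i f i * g i = c * g i0.
Proof.
move=> f0 fc; rewrite (bigD1 i0) //= fc big1 ?addr0 // => i ii0.
by rewrite f0 ?mul0r.
Qed.

(** For [0 < p < 1], let L be the sum of the [t i *: E i] and T the right-hand side. Optimality
    against [v] gives [tr L^p <= (1 - p e a) tr H^p], while the spectral bound gives
    [tr L^p >= tr H^p - p e / (1 - e) T]; comparing the two proves the claim. *)
Lemma kiefer_shrink : a * (\sum_j h 0 j `^ p) * (1 - e) <= trpowmul U h (p - 1) (E i0).
Proof.
have [e0 e1] := andP e01.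
have e1' : 0 < 1 - e by lra.
have [|V [l [Ldec l0]]] := @psd_eigdec _ _ (\sum_i t i *: E i).
  by apply: psdmx_sum => i; [exact: E_psd|exact: ltW].
have Vdec : eigdec (infomx M v) V ((1 - e * a)^-1 *: l).
  by rewrite shrink_infomx; exact: eigdecZ.
have l0' k : 0 <= ((1 - e * a)^-1 *: l) 0 k.
  by rewrite mxE mulr_ge0 // invr_ge0 ltW.
have Hdec' : eigdec (\sum_i E i) U h by exact: Hdec.
have upper_p : 0 < p -> \sum_k l 0 k `^ p <= (1 - p * (e * a)) * \sum_j h 0 j `^ p.
  move=> p0.
  have := optimal_sum_powR m_gt0 w_opt Hdec p0 shrink_feasible Vdec l0'.
  under eq_bigr => k _ do rewrite mxE powRM ?invr_ge0 ?(ltW ea_gt0) //.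
  rewrite -mulr_sumr.
  have -> : (1 - e * a)^-1 `^ p = ((1 - e * a) `^ p)^-1.
    by rewrite -(powR_inv1 (ltW ea_gt0)) -powRrM mulN1r powRN.
  rewrite ler_pdivrMl ?powR_gt0 // => /le_trans; apply.
  rewrite ler_wpM2r ?sumr_ge0 // => [j _|]; first exact: powR_ge0.
  have := @powR_le_tangent1 R p (1 - e * a); rewrite p_ge0 p_le1 (ltW ea_gt0).
  by move=> /(_ isT isT); move: (a) => b; lra.
(* Here [H] may be singular. The power 0 is 1 even at 0, so [trpowmul] with exponent 0 is a plain
   trace and everything is linear in [t]. *)
have [p1|p1] := eqVneq p 1.
  have p0 : 0 < p by rewrite p1.
  have := upper_p p0.
  have -> : \sum_k l 0 k `^ p = \sum_i t i * trpowmul U h (p - 1) (E i).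
    rewrite p1 subrr; under eq_bigr do rewrite powRr1 //.
    rewrite [LHS](overlap_sum_l Hdec' Ldec id).
    under [RHS]eq_bigr do rewrite mulr_sumr.
    rewrite [RHS]exchange_big /=; apply: eq_bigr => j _.
    rewrite -(reweight_row_sumM U Ldec (erefl _)).
    by apply: eq_bigr => i _; rewrite powRr0 mul1r.
  have -> : \sum_j h 0 j `^ p = \sum_i trpowmul U h (p - 1) (E i).
    rewrite p1 subrr; under eq_bigr do rewrite powRr1 //.
    rewrite [RHS]exchange_big /=; apply: eq_bigr => j _.
    rewrite -(reweight_row_sum Hdec' (erefl _)).
    by apply: eq_bigr => i _; rewrite powRr0 mul1r.
  set S := \sum_i trpowmul _ _ _ _.
  have -> : \sum_i t i * trpowmul U h (p - 1) (E i) = S - e * trpowmul U h (p - 1) (E i0).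
    rewrite -(@shrink_sum (fun i => 1 - t i) (fun i => trpowmul U h (p - 1) (E i)) e).
    - by rewrite -sumrB; apply: eq_bigr => i _; ring.
    - by move=> i /negPf ii0; rewrite /t ii0 subrr.
    - by rewrite /t eqxx; ring.
  have S0 : 0 <= S by rewrite sumr_ge0 // => i _; apply/trpowmul_ge0/E_psd.
  rewrite p1 mul1r => le; have : e * (a * S) <= e * trpowmul U h (1 - 1) (E i0).
    move: le; move: (a) (trpowmul _ _ _ (E i0)) => b c; lra.
  rewrite ler_pM2l // => /(le_trans _); apply.
  by rewrite ler_piMr ?(mulr_ge0 a_ge0 S0) // gerBl ltW.
have h0 : forall j, 0 < h 0 j.
  apply: (optimal_pd m_gt0 M_psd M_rank N_ge1 p_ge0 p_le1 w_opt Hdec h_ge0).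
  by rewrite lt_neqAle p1.
have lk k : 0 < l 0 k.
  rewrite -(eigdec_qf_diag k Ldec).
  apply: lt_le_trans (_ : (1 - e) * qf (\sum_i E i) (row k V) <= _).
    by rewrite mulr_gt0 // (eigdec_qf_gt0 _ Hdec') // Ldec.1.
  rewrite -qfZ scaler_sumr !qf_sum; apply: ler_sum => i _.
  rewrite ler_wpM2r ?psdmx_qf_ge0 //.
  by rewrite /t; case: ifP => // _; lra.
have lower b (f : R -> R) : 0 <= b ->
    (forall x y, 0 < x -> 0 < y -> x `^ p * (b * (1 - x / y)) <= f y - f x) ->
    - (b * (e / (1 - e) * trpowmul U h (p - 1) (E i0))) <=
    \sum_k f (l 0 k) - \sum_j f (h 0 j).
  move=> b0 fb.
  have := spectral_sum_lower_bound (fun i u => psdmx_qf_ge0 u (E_psd i)) t_gt0 Hdec' Ldec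
    h0 lk (erefl _) (erefl _) b0 fb.
  apply: le_trans; rewrite (@shrink_sum _ _ (- (e / (1 - e)))).
  - by rewrite mulNr mulrN.
  - by move=> i /negPf ii0; rewrite /t ii0 invr1 subrr.
  - by rewrite /t eqxx; field; rewrite gt_eqF.
have conclude b : 0 < b ->
    - (b * (e / (1 - e) * trpowmul U h (p - 1) (E i0))) <=
    - (b * (e * a) * \sum_j h 0 j `^ p) ->
    a * (\sum_j h 0 j `^ p) * (1 - e) <= trpowmul U h (p - 1) (E i0).
  move=> b0; set S := \sum_j _; set T := trpowmul _ _ _ _.
  rewrite lerN2 -mulrA ler_pM2l // => le.
  have := ler_wpM2r (ltW e1') le.
  have -> : e / (1 - e) * T * (1 - e) = e * T by field; rewrite gt_eqF.
  by rewrite -!mulrA ler_pM2l.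
have [p0|pn] := eqVneq p 0; last first.
  have p0 : 0 < p by rewrite lt0r pn.
  apply: (conclude p p0).
  have := lower p (@powR R ^~ p) p_ge0 (fun x y => @powR_lower_bound R p x y p_ge0).
  by move=> /le_trans; apply; have := upper_p p0; rewrite mulrBl mul1r; lra.
(* For [p = 0] the same comparison is made between log-determinants. *)
apply: (conclude 1 ltr01).
have fb x y : 0 < x -> 0 < y -> x `^ p * (1 * (1 - x / y)) <= ln y - ln x.
  by move=> x0 y0; rewrite p0 powRr0 !mul1r; exact: ln_lower_bound.
apply: le_trans (lower 1 (@ln R) ler01 fb) _.
have := optimal_prod m_gt0 w_opt Hdec h_ge0 p0 shrink_feasible Vdec l0'.
have ia0 : 0 < (1 - e * a)^-1 by rewrite invr_gt0.
have l0'' k : 0 < ((1 - e * a)^-1 *: l) 0 k by rewrite mxE mulr_gt0.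
rewrite -ler_ln ?posrE ?prodr_gt0 // !ln_prod // -subr_ge0 -sumrB => le.
have ln_ea : ln (1 - e * a) <= - (e * a).
  by apply: le_ln1Dx; move: ea_gt0; move: (a) => b; lra.
rewrite mul1r -subr_ge0 (_ : _ - _ = \sum_j (ln (h 0 j) - ln (l 0 j) - e * a)).
  apply: le_trans le _; apply: ler_sum => k _.
  rewrite mxE lnM ?posrE // lnV ?posrE //; move: ln_ea; move: (a) => b; lra.
rewrite !sumrB p0; under [in LHS]eq_bigr do rewrite powRr0.
rewrite mulr_sumr; under [in LHS]eq_bigr do rewrite mulr1.
by ring.
Qed.

End Shrink.

(** The limit of [kiefer_shrink] as [e] tends to 0. *)
Lemma kiefer i : w i / N%:R * (\sum_j h 0 j `^ p) <= trpowmul U h (p - 1) (E i).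
Proof.
apply: le_of_le_shrink; first exact/trpowmul_ge0/E_psd.
by move=> e e01; exact: kiefer_shrink.
Qed.

End Kiefer.

(** * The inequality *)

Section Majorization.
Variables (R : realType) (n : nat) (I : finType).
Variables (E : I -> 'M[R]_n) (p : R) (U : 'M[R]_n) (h : 'rV[R]_n).
Hypothesis E_psd : forall i, psdmx (E i).
Hypotheses (p_gt0 : 0 < p) (p_le1 : p <= 1).
Hypothesis Hdec : eigdec (\sum_i E i) U h.
Hypothesis h_gt0 : forall j, 0 < h 0 j.

(** Vanishing [t i] are reached by applying [sum_powR_ge_tangent] to [t i + e]; [peierls] and
    subadditivity of the power bound the cost of the perturbation. [L] need only dominate the
    weighted sum, which allows summands absent from [E]. *)
Lemma weighted_trace_le (t : I -> R) L V l : (forall i, 0 <= t i) ->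
  eigdec L V l -> (forall k, 0 <= l 0 k) ->
  (forall u, qf (\sum_i t i *: E i) u <= qf L u) ->
  \sum_i t i `^ p * trpowmul U h (p - 1) (E i) <= \sum_k l 0 k `^ p.
Proof.
move=> t0 Ldec l0 tL; apply/ler_addgt0Pr => d d0.
pose eta k := qf (\sum_i E i) (row k V).
have eta0 k : 0 <= eta k by apply/ltW/(eigdec_qf_gt0 _ Hdec h_gt0)/Ldec.1.
pose S := \sum_k eta k `^ p.
have S0 : 0 <= S by rewrite sumr_ge0 // => k _; exact: powR_ge0.
(* The perturbation costs at most [e^p * S = b * S], which is below [d]. *)
pose b := d / (S + 1).
have b0 : 0 < b by rewrite divr_gt0 //; lra.
pose e := b `^ p^-1.
have e0 : 0 < e by exact: powR_gt0.
have ep : e `^ p = b by rewrite -powRrM mulVf ?gt_eqF // powRr1 // ltW.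
have te i : 0 < t i + e by rewrite ltr_wpDl.
have teE i : ((t i + e) `^ p) `^ p^-1 = t i + e.
  by rewrite -powRrM mulfV ?gt_eqF // powRr1 // ltW.
have [|V' [l' [L'dec l'0]]] := @psd_eigdec _ _ (\sum_i (t i + e) *: E i).
  by apply: psdmx_sum => // i; exact: ltW.
have L'dec' : eigdec (\sum_i ((t i + e) `^ p) `^ p^-1 *: E i) V' l'.
  by under eq_bigr do rewrite teE.
have main := sum_powR_ge_tangent E_psd (fun i => powR_gt0 p (te i)) p_gt0 p_le1
  Hdec h_gt0 L'dec' l'0.
apply: le_trans (_ : \sum_i (t i + e) `^ p * trpowmul U h (p - 1) (E i) <= _).
  apply: ler_sum => i _; rewrite ler_wpM2r ?trpowmul_ge0 //.
  by rewrite ge0_ler_powR ?nnegrE ?lerDl ?(ltW e0) ?(ltW p_gt0) ?(ltW (te i)).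
apply: le_trans main _.
have p01 : 0 < p <= 1 by rewrite p_gt0.
apply: le_trans (peierls p01 L'dec l'0 Ldec.1) _.
apply: le_trans (_ : \sum_k (l 0 k `^ p + b * eta k `^ p) <= _).
  apply: ler_sum => k _.
  have lk : 0 <= e * eta k by rewrite mulr_ge0 // ltW.
  apply: le_trans (_ : (l 0 k + e * eta k) `^ p <= _).
    rewrite ge0_ler_powR ?nnegrE ?(ltW p_gt0) ?addr_ge0 //.
      rewrite qf_sum sumr_ge0 // => i _.
      by rewrite mulr_ge0 ?psdmx_qf_ge0 // ltW.
    have -> : \sum_i (t i + e) *: E i = \sum_i t i *: E i + e *: \sum_i E i.
      by rewrite scaler_sumr -big_split; apply: eq_bigr => i _; rewrite scalerDl.
    by rewrite qfD qfZ lerD2r -(eigdec_qf_diag k Ldec).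
  apply: le_trans (powRD_le p01 (l0 k) lk) _.
  by rewrite powRM ?(ltW e0) // ep.
rewrite big_split -mulr_sumr lerD2l -/S /b mulrAC ler_pdivrMr; last by lra.
by rewrite ler_pM2l //; lra.
Qed.

End Majorization.

Lemma trpowmul_sum (R : realType) (n : nat) (I : finType) (U : 'M[R]_n) h a
    (x : I -> R) (E : I -> 'M[R]_n) :
  trpowmul U h a (\sum_i x i *: E i) = \sum_i x i * trpowmul U h a (E i).
Proof.
rewrite /trpowmul; under [RHS]eq_bigr do rewrite mulr_sumr.
rewrite [RHS]exchange_big; apply: eq_bigr => j _ /=.
by rewrite qf_sum mulr_sumr; apply: eq_bigr => i _; exact: mulrCA.
Qed.

(** Neither exponent is 0 here, so [pow00] is the usual power. For [y = 0] both sides vanish, as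
    [x / 0 = 0]. *)
Lemma pow00_mul (R : realType) (x y p : R) : 0 < p < 1 -> 0 <= x -> 0 <= y ->
  pow00 x p * pow00 y (1 - p) = (x / y) `^ p * y.
Proof.
move=> /andP[p0 p1] x0 y0; rewrite /pow00.
have [->|yn] := eqVneq y 0; first by rewrite !mulr0.
have [->|xn] := eqVneq x 0; first by rewrite !mul0r powR0 ?mul0r // gt_eqF.
rewrite powRM ?invr_ge0 // powRB ?yn ?implybT // powRr1 //.
by rewrite -(powR_inv1 y0) -powRrM mulN1r powRN mulrAC mulrA.
Qed.

Theorem proposition3p3 (R : realType) (m s : nat) (m_gt0 : (0 < m)%N)
    (M : 'I_s -> 'M[R]_m) (M_psd : forall i, psdmx (M i))
    (M_rank : \rank (\sum_(k < s) M k)%R = m)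
    (N : nat) (N_ge1 : (1 <= N)%N)
    (p : R) (p_ge0 : 0 <= p) (p_le1 : p <= 1)
    (w : 'I_s -> R) (w_opt : optimal M N p w)
    (n : 'I_s -> nat) :
  N%:R^-1 * \sum_(i < s) pow00 (n i)%:R p * pow00 (w i) (1 - p)
    <= phi M p (fun i => (n i)%:R) / phi M p w.
Proof.
have w0 i : 0 <= w i by case: w_opt => -[].
have N0 : 0 < N%:R :> R by rewrite ltr0n.
have Hpsd : psdmx (infomx M w) by exact: infomx_psd.
have Lpsd : psdmx (infomx M (fun i => (n i)%:R)) by exact: infomx_psd.
have [U [h [Hdec h0]]] := psd_eigdec Hpsd.
have kf := kiefer m_gt0 M_psd M_rank N_ge1 p_ge0 p_le1 w_opt Hdec h0.
pose E i := w i *: M i.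
have Epsd i : psdmx (E i) by exact: psdmxZ.
rewrite /phi; have [p0|pn] := eqVneq p 0.
  have hpos : forall j, 0 < h 0 j.
    apply: (optimal_pd m_gt0 M_psd M_rank N_ge1 p_ge0 p_le1 w_opt Hdec h0).
    by rewrite p0.
  have rH : \rank (infomx M w) = m.
    rewrite mxrank_unit // unitmxE (eigdec_det Hdec) unitfE.
    by apply/prodf_neq0 => j _; rewrite gt_eqF.
  rewrite /trace_pow p0 eqxx rH ler_pdivlMr ?ltr0n //.
  (* Restricting [H] to the indices with [n i != 0] gives a matrix below [H] whose rank is at most
     that of the matrix of [n]. *)
  pose d i : R := (n i != 0)%:R.
  have Apsd : psdmx (\sum_i d i *: E i) by apply: psdmx_sum => // i; rewrite /d ler0n.
  apply: le_trans (_ : (\rank (\sum_i d i *: E i)%R)%:R <= _); last first.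
    rewrite ler_nat; apply: psd_rank_le => // u uL.
    have : qf (infomx M (fun i => (n i)%:R)) u = 0 by rewrite /qf uL mul0mx mxE.
    rewrite !qf_sum => /eqP; rewrite psumr_eq0 => [/allP uM|i _]; last first.
      by rewrite mulr_ge0 ?psdmx_qf_ge0.
    rewrite big1 // => i _; have := uM i (mem_index_enum _).
    rewrite /= mulf_eq0 pnatr_eq0 /d qfZ => /orP[-> |/eqP ->]; first by rewrite mul0r.
    by rewrite !mulr0.
  apply: le_trans (trace_inv_le_rank Apsd Hdec hpos _); last first.
    move=> u; rewrite !qf_sum; apply: ler_sum => i _; rewrite qfZ.
    have wq : 0 <= w i * qf (M i) u by rewrite mulr_ge0 ?psdmx_qf_ge0.
    by rewrite /d; case: (n i != 0); rewrite ?mul1r ?mul0r.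
  rewrite trpowmul_sum mulr_sumr mulr_suml; apply: ler_sum => i _.
  have := kf i; rewrite p0 sub0r subr0 -/(E i); under eq_bigr do rewrite powRr0.
  rewrite sumr_const card_ord => kfi.
  (* The convention [0^0 = 0] is what turns [pow00 (n i)%:R 0] into the indicator [d i]. *)
  have -> : N%:R^-1 * (pow00 (n i)%:R 0 * pow00 (w i) 1) * m%:R =
      d i * (w i / N%:R * m%:R).
    rewrite /pow00 /d pnatr_eq0 powRr0 powRr1 //.
    by case: eqVneq => _; case: eqVneq => [->|_]; rewrite /=; ring.
  by rewrite ler_wpM2l // /d ler0n.
have p0 : 0 < p by rewrite lt0r pn.
have [V [l [Ldec l0]]] := psd_eigdec Lpsd.
have S0 := optimal_sum_powR_gt0 m_gt0 M_psd M_rank N_ge1 w_opt Hdec p0.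
rewrite (eigdec_trace_pow pn Hdec) (eigdec_trace_pow pn Ldec).
rewrite ler_pdivlMr // mulrAC mulrC; set S := \sum_j _ in S0 kf *.
have [p1|p1] := eqVneq p 1.
  have -> : \sum_k l 0 k `^ p = \sum_i (n i)%:R * trpowmul U h (p - 1) (M i).
    rewrite -trpowmul_sum p1 subrr; under eq_bigr do rewrite powRr1 //.
    rewrite [LHS](overlap_sum_l Hdec Ldec id); apply: eq_bigr => j _.
    rewrite powRr0 mul1r (eigdec_qf_row _ _ Ldec).
    by apply: eq_bigr => k _; rewrite mulrC.
  rewrite mulr_suml; apply: ler_sum => i _; rewrite p1 subrr /pow00 !powRr0 powRr1 //.
  have -> : (if (n i)%:R == 0 :> R then 0 else (n i)%:R) = (n i)%:R :> R.
    by case: ifP => // /eqP ->.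
  rewrite -mulrA ler_wpM2l //.
  (* [pow00 (w i) 0] is 0 when [w i = 0]; otherwise [w i] cancels from [kiefer]. *)
  have [wi0|wi] := eqVneq (w i) 0; first by rewrite mul0r trpowmul_ge0.
  rewrite mul1r; have := kf i; rewrite trpowmulZ p1 subrr -mulrA.
  by rewrite ler_pM2l ?lt0r ?wi ?w0.
have p01 : 0 < p < 1 by rewrite p0 lt_neqAle p1.
have hpos : forall j, 0 < h 0 j.
  case/andP: p01 => _.
  exact: (optimal_pd m_gt0 M_psd M_rank N_ge1 p_ge0 p_le1 w_opt Hdec h0).
under eq_bigr do rewrite pow00_mul //.
(* Division by 0 gives [t i = 0] when [w i = 0]. The sum of the [t i *: E i] then omits [n i] times
   [M i], so it is only dominated by the matrix of [n]. *)
pose t i := (n i)%:R / w i.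
apply: le_trans (_ : \sum_i t i `^ p * trpowmul U h (p - 1) (E i) <= _).
  rewrite mulr_suml; apply: ler_sum => i _; rewrite -mulrA ler_wpM2l ?powR_ge0 //.
  by have := kf i; rewrite -/(E i) mulrA.
apply: (weighted_trace_le Epsd p0 p_le1 Hdec hpos _ Ldec l0) => [i|u].
  by rewrite divr_ge0.
rewrite !qf_sum; apply: ler_sum => i _; rewrite qfZ mulrA /t.
have [->|wn] := eqVneq (w i) 0; first by rewrite mulr0 mul0r mulr_ge0 ?psdmx_qf_ge0.
by rewrite divfK.
Qed.
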